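(* Let $w^1,\dots,w^d\in S_n$ with $\sum_{i=1}^d \ell(w^i)=\binom n2$, let $E^1_\bullet,\dots,E^d_\bullet$ be generally chosen flags in $\mathcal{F}\ell_n$, and let $$X=X_{w^1}(E^1_\bullet)\cap X_{w^2}(E^2_\bullet)\cap\cdots\cap X_{w^d}(E^d_\bullet).$$ If $X$ is $0$-dimensional and nonempty, then there exists a unique permutation array $P\subset[n]^{d+1}$ such that $$\dim\left(E^1_{x_1}\cap E^2_{x_2}\cap\cdots\cap E^d_{x_d}\cap F_{x_{d+1}}\right)=\mathrm{rk}\,P[x]$$ for all $F_\bullet\in X$ and all $x\in[n]^{d+1}$. Hence $X$ is equal to the fiber permutation array variety $X^o_P(E^1_\bullet,\dots,E^d_\bullet)$.
   Context: Work over an arbitrary field $K$. $\mathcal{F}\ell_n$ is the variety of complete flags $F_\bullet=\{0=F_0\subset F_1\subset\cdots\subset F_n=K^n\}$, $\dim F_i=i$. ''Generally chosen'' flags $E^1_\bullet,\dots,E^d_\bullet$ means that the statement holds for all $(E^1_\bullet,\dots,E^d_\bullet)$ in a suitable dense Zariski-open subset of $\mathcal{F}\ell_n^d$. Schubert varieties. To $w\in S_n$ associate the $n\times n$ matrix with a $1$ in row $w(i)$ of column $n-i+1$ for $1\le i\le n$ and $0$ elsewhere (a nonstandard labelling); $w[i,j]$ is its upper-left submatrix formed by rows $1,\dots,i$ and columns $1,\dots,j$. $\ell(w)$ is the number of inversions of $w$. The Schubert variety is $X_w(F_\bullet)=\{G_\bullet\in\mathcal{F}\ell_n : \dim(F_i\cap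 G_j)\ge \mathrm{rank}\,w[i,j]\text{ for all }1\le i,j\le n\}$; it is the closure of the Schubert cell $X_w^o(F_\bullet)$ defined by the same conditions with equality, and has codimension $\ell(w)$. Permutation arrays. Let $[n]=\{1,\dots,n\}$. For $x,y\in[n]^m$ write $x\preceq y$ if $x_i\le y_i$ for all $i$; $\bigvee R$ is the coordinatewise maximum of a set $R$. A dot array is a subset $P\subset[n]^m$; $P[y]=\{x\in P: x\preceq y\}$. Put $\mathrm{rk}_jP=\#\{k\in [n]:\exists x\in P,\ x_j=k\}$. $P$ is rankable of rank $r$, written $\mathrm{rk}\,P=r$, if $\mathrm{rk}_jP=r$ for all $j$; it is totally rankable if $P[y]$ is rankable for every $y\in[n]^m$. A position $x$ is redundant in $P$ if there is $R\subset P$ with $x=\bigvee R$, $\#R>1$, and every $y\in R$ has at least one coordinate $y_i=x_i$. A permutation array in $[n]^m$ is a totally rankable dot array of rank $n$ no element of which is redundant. Fiber permutation array variety. For a permutation array $P\subset[n]^{d+1}$ and flags $E^1_\bullet,\dots,E^d_\bullet$, $X^o_P(E^1_\bullet,\dots,E^d_\bullet)$ is the set of flags $F_\bullet\in\mathcal{F}\ell_n$ with $\dim(E^1_{x_1}\cap\cdots\cap E^d_{x_d}\cap F_{x_{d+1}})=\mathrm{rk}\,P[x]$ for all $x\in[n]^{d+1}$. *)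

(* Defs.v *)
From HB Require Import structures.
From mathcomp Require Import all_boot all_order all_algebra all_fingroup.
From mathcomp Require Import mpoly.

Set Implicit Arguments.
Unset Strict Implicit.
Unset Printing Implicit Defensive.

Import GRing.Theory.
Local Open Scope ring_scope.

Section Topology.

(* [op] is the collection of open subsets of the space [T]. *)
Variables (T : Type) (op : (T -> Prop) -> Prop).
Implicit Types (X Z U : T -> Prop).

Definition nonempty X := exists x, X x.

Definition included X Z := forall x, X x -> Z x.

Definition is_dense U :=
  forall V, op V -> nonempty V -> exists x, V x /\ U x.

Definition is_closed Z := op (fun x => ~ Z x).

Definition irreducible Z :=
  nonempty Z /\
  forall A B, is_closed A -> is_closed B ->
    included Z (fun x => A x \/ B x) -> included Z A \/ included Z B.

Definition irreducible_closed_in X Z :=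
  irreducible Z /\
  exists2 C, is_closed C & forall x, Z x <-> X x /\ C x.

Definition irreducible_chain X (k : nat) :=
  exists Z : nat -> T -> Prop,
    (forall i, (i <= k)%N -> irreducible_closed_in X (Z i)) /\
    (forall i, (i < k)%N -> included (Z i) (Z i.+1) /\ ~ included (Z i.+1) (Z i)).

(* A chain can always be shortened, so this says that [k] is the supremum of
   the lengths of the chains. *)
Definition krull_dim X (k : nat) :=
  irreducible_chain X k /\ ~ irreducible_chain X k.+1.

End Topology.

Section Flags.

Variables (L : fieldType) (n : nat).

Record flag := Flag {
  flag_space :> {ffun 'I_n.+1 -> {vspace 'rV[L]_n}};
  flag_dim : forall i, \dim (flag_space i) = i;
  flag_mono : forall i j : 'I_n.+1, (i <= j)%N ->
    (flag_space i <= flag_space j)%VS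
}.

(* Indices 1, ..., n are encoded by 'I_n, with k standing for k + 1;
   [lift ord0 k : 'I_n.+1] has value k + 1. *)
Definition flag_at (F : flag) (k : 'I_n) : {vspace 'rV[L]_n} :=
  F (lift ord0 k).

(* [g] represents F under GL_n -> GL_n / B.  Since dim F_i = i, such a [g] is
   automatically invertible. *)
Definition represents (g : 'M[L]_n) (F : flag) :=
  forall i : 'I_n.+1, F i = <<[seq row k g | k : 'I_n <- enum 'I_n & (k < i)%N]>>%VS.

End Flags.

Section Zariski.

Variables (K L : fieldType) (iota : {rmorphism K -> L}) (d n : nat).

Definition coord : finType := ('I_d * 'I_n * 'I_n)%type.

Definition entries (g : 'I_d -> 'M[L]_n) (c : 'I_#|coord|) : L :=
  let: (i, a, b) := enum_val c in g i a b.

(* The Zariski topology of the K-variety Fl_n^d on its set of L-points (meant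
   for algebraically closed L), as the quotient topology of GL_n^d: U is open
   iff its preimage in GL_n^d is the union of the nonvanishing loci of a set S
   of polynomials with coefficients in K in the matrix entries. *)
Definition zariski_open (U : {ffun 'I_d -> flag L n} -> Prop) :=
  exists S : {mpoly K[#|coord|]} -> Prop,
    forall (E : {ffun 'I_d -> flag L n}) (g : 'I_d -> 'M[L]_n),
      (forall i, represents (g i) (E i)) ->
      (U E <-> exists2 p, S p & (map_mpoly iota p).@[entries g] != 0).

End Zariski.

(* The dimension is that of the underlying (geometric) variety, computed in
   Fl_n = Fl_n^1 with the Zariski topology over L itself. *)
Definition flag_variety_dim (L : fieldType) (n : nat)
    (X : flag L n -> Prop) (k : nat) :=
  krull_dim (@zariski_open L L idfun 1 n) (fun F => X (F ord0)) k.

Section Schubert.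

Variables (L : fieldType) (n : nat).

Definition perm_length (w : 'S_n) : nat :=
  #|[set p : 'I_n * 'I_n | (p.1 < p.2)%N && (w p.2 < w p.1)%N]|.

(* The 1 of column n - i + 1 (that is, [rev_ord i]) is in row w(i). *)
Definition schubert_mx (w : 'S_n) : 'M[L]_n :=
  \matrix_(r, c) (r == w (rev_ord c))%:R.

Definition upper_left (w : 'S_n) (i j : 'I_n) : 'M[L]_(i.+1, j.+1) :=
  mxsub (widen_ord (ltn_ord i)) (widen_ord (ltn_ord j)) (schubert_mx w).

Definition schubert_variety (w : 'S_n) (F G : flag L n) : Prop :=
  forall i j : 'I_n,
    (\rank (upper_left w i j) <= \dim (flag_at F i :&: flag_at G j))%N.

End Schubert.

Section PermutationArrays.

Variables (m n : nat).

Definition position := {ffun 'I_m -> 'I_n}.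

Implicit Types (P R : {set position}) (x y : position).

Definition pos_le x y := [forall i, (x i <= y i)%N].

Definition below P y := [set x in P | pos_le x y].

Definition rank_along (j : 'I_m) P : nat :=
  #|[set k : 'I_n | [exists x in P, x j == k]]|.

Definition has_rank P (r : nat) := forall j, rank_along j P = r.

Definition totally_rankable P := forall y, exists r, has_rank (below P y) r.

Definition is_join R x := forall i, nat_of_ord (x i) = (\max_(y in R) y i)%N.

Definition redundant P x :=
  exists R : {set position},
    [/\ R \subset P, is_join R x, (1 < #|R|)%N &
        forall y, y \in R -> exists i, y i = x i].

Definition permutation_array P :=
  [/\ totally_rankable P, has_rank P n &
      forall x, x \in P -> ~ redundant P x].

End PermutationArrays.

Section FiberVariety.

Variables (L : fieldType) (d n : nat).

(* The last coordinate of x belongs to F, the first d ones to the E i. *)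
Definition meet_dim (E : {ffun 'I_d -> flag L n}) (F : flag L n)
    (x : position d.+1 n) : nat :=
  \dim ((\bigcap_(i < d) flag_at (E i) (x (widen_ord (leqnSn d) i)))
        :&: flag_at F (x ord_max)).

Definition fiber_array_variety (P : {set position d.+1 n})
    (E : {ffun 'I_d -> flag L n}) (F : flag L n) : Prop :=
  forall x, has_rank (below P x) (meet_dim E F x).

Definition schubert_intersection (w : 'I_d -> 'S_n)
    (E : {ffun 'I_d -> flag L n}) (F : flag L n) : Prop :=
  forall i, schubert_variety (w i) (E i) F.

End FiberVariety.

(* Main.v *)
Require Import Defs.
From HB Require Import structures.
From mathcomp Require Import all_boot all_order all_algebra all_fingroup.
From mathcomp Require Import mpoly zify.
From Stdlib Require Import ClassicalEpsilon.

Set Implicit Arguments.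
Unset Strict Implicit.
Unset Printing Implicit Defensive.

Import GRing.Theory.
Local Open Scope ring_scope.

(** The table of dimensions of the meets of d + 1 flags takes finitely many
    values, and on an irreducible family it is constant on a dense open set.
    The incidence variety of all (F, E) with F in the Schubert intersection of E
    has the dimension of the space of all E, because the codimensions of the
    Schubert conditions add up to the dimension of the flag variety of F.  The
    locus where the table is not the generic one has smaller dimension, so its
    projection misses a dense open set U of E, and for E in U all points of the
    intersection have the same table.

    This is carried out with explicit parameters.  By the Bruhat decomposition
    ([exists_reduced], [exists_param]) the configurations with all their matrix
    representatives are covered by finitely many strata, images of affine spaces
    under polynomial maps over K into the d-tuples of matrices.  A Schubert
    condition bounds a rank matrix from below; larger rank matrices belong to
    permutations with fewer inversions ([inversions_rank_lt]), so all strata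
    that occur have dimension less than d n ^ 2, except one of dimension d n ^ 2
    ([admissible_dim]).  A polynomial map to a space of larger dimension has its
    image in a hypersurface, and between spaces of equal dimension so does the
    image of a hypersurface; both follow from algebraic dependence, proved by
    counting monomials ([image_hypersurface]).  On the large stratum the
    dimensions are generically constant since ranks are given by minors
    ([generic_rank]).  The product of the equations found is a nonzero
    polynomial Q over K off which the table does not depend on F
    ([generic_polynomial]), and U consists of the E with a representative g such
    that Q g <> 0.

    That the table of any family of flags is the rank function of a permutation
    array is linear algebra ([flag_array_permutation], [flag_array_rank]).
    Assign to a nonzero vector the steps at which it enters the flags; the array
    consists of the positions obtained in this way under which there is no other
    one with a common coordinate.  The ranks determine a permutation array
    because a dot of one array which is missing in another array with the same
    ranks would be redundant ([permutation_array_unique]). *)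

(** * Preliminaries on finite sets *)

Lemma ord_min n (P : pred 'I_n) i0 : P i0 -> exists2 i, P i & forall j, P j -> (i <= j)%N.
Proof. by move=> Pi0; case: (arg_minnP val Pi0) => i Pi i_min; exists i. Qed.

Lemma sum_leq_eq k (a b : 'I_k -> nat) : (forall i, a i <= b i)%N ->
  (\sum_i b i <= \sum_i a i)%N -> a =1 b.
Proof.
move=> le_ab le_sum i; apply/eqP; rewrite eqn_leq le_ab /=.
rewrite -(leq_add2r (\sum_(j | j != i) a j)).
move: le_sum; rewrite (bigD1 i) //= [leqRHS](bigD1 i) //=; apply: leq_trans.
by rewrite leq_add2l leq_sum.
Qed.

(** * Polynomials over an algebraically closed field *)

Lemma digits_inj B k (m m' : 'I_k -> nat) :
  (forall i, (m i < B)%N) -> (forall i, (m' i < B)%N) ->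
  (\sum_(i < k) m i * B ^ i = \sum_(i < k) m' i * B ^ i)%N -> m =1 m'.
Proof.
elim: k m m' => [|k IH] m m' mB m'B; first by move=> _ [].
have B_gt0 : (0 < B)%N := leq_ltn_trans (leq0n _) (mB ord0).
have shift (f : 'I_k.+1 -> nat) : (\sum_(i < k.+1) f i * B ^ i =
    (\sum_(i < k) f (lift ord0 i) * B ^ i) * B + f ord0)%N.
  rewrite big_ord_recl expn0 muln1 addnC big_distrl; congr addn.
  by apply: eq_bigr => i _; rewrite /= expnS [(B * _)%N]mulnC mulnA.
rewrite !shift => eq_mm'.
have eq0 : m ord0 = m' ord0.
  by have := congr1 (modn^~ B) eq_mm'; rewrite !modnMDl !modn_small.
move: eq_mm'; rewrite eq0 => /addIn/eqP; rewrite eqn_pmul2r // => /eqP/IH eqS i.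
have [j ->|->] := unliftP ord0 i; last exact: eq0.
by apply: eqS => j'.
Qed.

(** Kronecker substitution: putting x ^ (B ^ i) for the i-th variable, with B
    larger than every exponent, sends distinct monomials to distinct powers
    of x, so p becomes a nonzero polynomial in one variable, which has a
    nonroot because L is infinite. *)
Lemma mpoly_nonvanishing (L : closedFieldType) k (p : {mpoly L[k]}) :
  p != 0 -> exists t : 'I_k -> L, p.@[t] != 0.
Proof.
move=> p_neq0; pose B := (msize p).+1.
pose e (m : 'X_{1..k}) := (\sum_(i < k) m i * B ^ i)%N.
pose q : {poly L} := \sum_(m <- msupp p) p@_m *: 'X^(e m).
have ltB (m : 'X_{1..k}) i : m \in msupp p -> (m i < B)%N.
  move=> /msize_mdeg_lt; rewrite ltnS => /ltnW; apply: leq_trans.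
  by rewrite mdegE (bigD1 i) //= leq_addr.
have q_neq0 : q != 0.
  have m0_supp := mlead_supp p_neq0; set m0 := mlead p in m0_supp.
  apply: contraTneq m0_supp => q0; rewrite -mcoeff_eq0 -[_@__](_ : q`_(e m0) = _).
    by rewrite q0 coef0.
  rewrite coef_sum (bigD1_seq m0) ?msupp_uniq ?mlead_supp //= coefZ coefXn eqxx mulr1.
  rewrite big_seq_cond big1 ?addr0 // => m /andP[m_supp m_neq].
  rewrite coefZ coefXn; case: eqP => [/esym em|]; last by rewrite mulr0.
  case/eqP: m_neq; apply/mnmP/(digits_inj _ _ em) => i; apply: ltB => //.
  exact: mlead_supp.
have /closed_nonrootP[x] := q_neq0; rewrite rootE => qx.
exists (fun i => x ^+ (B ^ i)); apply: contraNneq qx => px0; rewrite -px0 mevalE.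
rewrite horner_sum; apply/eqP/eq_bigr => m _; rewrite hornerZ hornerXn.
congr (_ * _); rewrite /e -prodrXr; apply: eq_bigr => i _.
by rewrite mulnC exprM.
Qed.

Section PolynomialFunctions.

Variables (K : fieldType) (L : closedFieldType) (iota : {rmorphism K -> L}).

Definition ev k (p : {mpoly K[k]}) (t : 'I_k -> L) : L := (map_mpoly iota p).@[t].

Lemma evD k (p q : {mpoly K[k]}) t : ev (p + q) t = ev p t + ev q t.
Proof. by rewrite /ev rmorphD mevalD. Qed.

Lemma evM k (p q : {mpoly K[k]}) t : ev (p * q) t = ev p t * ev q t.
Proof. by rewrite /ev rmorphM mevalM. Qed.

Lemma ev0 k (t : 'I_k -> L) : ev 0 t = 0.
Proof. by rewrite /ev rmorph0 meval0. Qed.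

Lemma ev1 k (t : 'I_k -> L) : ev 1 t = 1.
Proof. by rewrite /ev rmorph1 meval1. Qed.

Lemma ev_nonvanishing k (p : {mpoly K[k]}) :
  p != 0 -> exists t, ev p t != 0.
Proof.
move=> p_neq0; apply: mpoly_nonvanishing; apply: contraNneq p_neq0 => p0.
apply/eqP/mpolyP => m; apply: (fmorph_inj iota).
by rewrite -mcoeff_map_mpoly p0 mcoeff0 mcoeff0 rmorph0.
Qed.

Lemma ev_comp k m (p : {mpoly K[m]}) (f : m.-tuple {mpoly K[k]}) t :
  ev (p \mPo f) t = ev p (fun i => ev (tnth f i) t).
Proof.
rewrite /ev map_mpoly_comp; last exact: fmorph_inj.
rewrite comp_mpoly_meval; apply: meval_eq => i.
by rewrite tnth_map.
Qed.

(** Functions on affine space over L which are given by polynomials over K.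
    Working with the functions avoids transporting matrices, determinants
    and adjugates to polynomial rings: their entries are polynomial by the
    closure properties below. *)
Definition polyfun k (phi : ('I_k -> L) -> L) :=
  exists p : {mpoly K[k]}, forall t, ev p t = phi t.

Section Closure.

Variable k : nat.
Implicit Types phi psi : ('I_k -> L) -> L.

Lemma polyfun_ext phi psi : phi =1 psi -> polyfun phi -> polyfun psi.
Proof. by move=> e [p pP]; exists p => t; rewrite pP e. Qed.

Lemma polyfun0 : polyfun (fun _ : 'I_k -> L => 0).
Proof. by exists 0; apply: ev0. Qed.

Lemma polyfun1 : polyfun (fun _ : 'I_k -> L => 1).
Proof. by exists 1; apply: ev1. Qed.

Lemma polyfun_var i : polyfun (fun t : 'I_k -> L => t i).
Proof. by exists 'X_i => t; rewrite /ev map_mpolyX mevalXU. Qed.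

Lemma polyfunD phi psi :
  polyfun phi -> polyfun psi -> polyfun (fun t => phi t + psi t).
Proof.
by move=> [p pP] [q qP]; exists (p + q) => t; rewrite evD pP qP.
Qed.

Lemma polyfunN phi : polyfun phi -> polyfun (fun t => - phi t).
Proof. by move=> [p pP]; exists (- p) => t; rewrite /ev rmorphN mevalN -pP. Qed.

Lemma polyfunM phi psi :
  polyfun phi -> polyfun psi -> polyfun (fun t => phi t * psi t).
Proof.
by move=> [p pP] [q qP]; exists (p * q) => t; rewrite evM pP qP.
Qed.

Lemma polyfun_sum (I : Type) (r : seq I) (P : pred I) (F : I -> ('I_k -> L) -> L) :
  (forall i, polyfun (F i)) -> polyfun (fun t => \sum_(i <- r | P i) F i t).
Proof.
move=> Fp; elim: r => [|i r IH].
  by apply: polyfun_ext polyfun0 => t; rewrite big_nil.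
apply: (@polyfun_ext (fun t => if P i then F i t + \sum_(j <- r | P j) F j t
                               else \sum_(j <- r | P j) F j t)).
  by move=> t; rewrite big_cons.
by case: (P i) => //; apply: polyfunD.
Qed.

Lemma polyfun_prod (I : Type) (r : seq I) (P : pred I) (F : I -> ('I_k -> L) -> L) :
  (forall i, polyfun (F i)) -> polyfun (fun t => \prod_(i <- r | P i) F i t).
Proof.
move=> Fp; elim: r => [|i r IH].
  by apply: polyfun_ext polyfun1 => t; rewrite big_nil.
apply: (@polyfun_ext (fun t => if P i then F i t * \prod_(j <- r | P j) F j t
                               else \prod_(j <- r | P j) F j t)).
  by move=> t; rewrite big_cons.
by case: (P i) => //; apply: polyfunM.
Qed.

Definition polymx a b (A : ('I_k -> L) -> 'M[L]_(a, b)) :=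
  forall i j, polyfun (fun t => A t i j).

Lemma polymxM a b c (A : ('I_k -> L) -> 'M[L]_(a, b)) (B : ('I_k -> L) -> 'M[L]_(b, c)) :
  polymx A -> polymx B -> polymx (fun t => A t *m B t).
Proof.
move=> Ap Bp i j; apply: (@polyfun_ext (fun t => \sum_l A t i l * B t l j)).
  by move=> t; rewrite mxE.
by apply: polyfun_sum => l; apply: polyfunM.
Qed.

Lemma polymx_sub a b a' b' f g (A : ('I_k -> L) -> 'M[L]_(a, b)) :
  polymx A -> polymx (fun t => mxsub f g (A t) : 'M_(a', b')).
Proof.
by move=> Ap i j; apply: polyfun_ext (Ap (f i) (g j)) => t; rewrite mxE.
Qed.

Lemma polyfun_det a (A : ('I_k -> L) -> 'M[L]_a) :
  polymx A -> polyfun (fun t => \det (A t)).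
Proof.
move=> Ap; apply: polyfun_sum => s; apply: polyfunM.
  by case: odd_perm; [apply: polyfunN; apply: polyfun1 | apply: polyfun1].
by apply: polyfun_prod.
Qed.

Lemma polymx_adj a (A : ('I_k -> L) -> 'M[L]_a) :
  polymx A -> polymx (fun t => \adj (A t)).
Proof.
move=> Ap i j; apply: (@polyfun_ext (fun t => (-1) ^+ (j + i) * \det (row' j (col' i (A t))))).
  by move=> t; rewrite mxE.
apply: polyfunM.
  rewrite -signr_odd; case: odd; last exact: polyfun1.
  by apply: polyfunN; apply: polyfun1.
apply: polyfun_det => i' j'; apply: polyfun_ext (Ap (lift j i') (lift i j')) => t.
by rewrite !mxE.
Qed.

End Closure.

(** * Algebraic dependence *)

Section Dependence.

Variable k : nat.
Implicit Types p q : {mpoly K[k]}.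

Definition mdeg_le c p := forall m, m \in msupp p -> (mdeg m <= c)%N.

Lemma mdeg_leM c c' p q : mdeg_le c p -> mdeg_le c' q -> mdeg_le (c + c') (p * q).
Proof.
move=> pc qc' m /msuppM_le/allpairsP[[m1 m2] /= [m1p m2q ->]].
by rewrite mdegD leq_add ?pc ?qc'.
Qed.

Lemma mdeg_le1 c : mdeg_le c 1.
Proof. by move=> m; rewrite msupp1 inE => /eqP->; rewrite mdeg0. Qed.

Lemma mdeg_leX c p e : mdeg_le c p -> mdeg_le (e * c) (p ^+ e).
Proof.
move=> pc; elim: e => [|e IH]; first by rewrite expr0; apply: mdeg_le1.
by rewrite exprS mulSn; apply: mdeg_leM.
Qed.

Lemma mdeg_le_prod c (I : finType) (P : I -> {mpoly K[k]}) :
  (forall i, mdeg_le c (P i)) -> mdeg_le (#|I| * c) (\prod_i P i).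
Proof.
move=> Pc; rewrite -sum_nat_const.
by apply: big_ind2 => [|c1 p1 c2 p2|//]; [apply: mdeg_le1 | apply: mdeg_leM].
Qed.

Lemma mdeg_leW c c' p : (c <= c')%N -> mdeg_le c p -> mdeg_le c' p.
Proof. by move=> le_cc' pc m /pc/leq_trans; apply. Qed.

Lemma mdeg_le_msize p : mdeg_le (msize p) p.
Proof. by move=> m /msize_mdeg_lt/ltnW. Qed.

End Dependence.

(** More unknowns than equations. *)
Lemma linear_relation (I J : finType) (A : I -> J -> K) : (#|J| < #|I|)%N ->
  exists2 u : I -> K, (exists i, u i != 0) & forall j, \sum_i u i * A i j = 0.
Proof.
move=> lt_JI; pose M := \matrix_(a < #|I|, b < #|J|) A (enum_val a) (enum_val b).
have /matrix0Pn[a [b kab]] : kermx M != 0.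
  by rewrite -mxrank_eq0 mxrank_ker subn_eq0 -ltnNge (leq_ltn_trans (rank_leq_col M)).
have uM : row a (kermx M) *m M = 0 by rewrite -row_mul mulmx_ker row0.
exists (fun i => row a (kermx M) 0 (enum_rank i)).
  by exists (enum_val b); rewrite enum_valK mxE.
move=> j; have := congr1 (fun N : 'rV_ _ => N 0 (enum_rank j)) uM.
rewrite mxE [RHS]mxE => e; rewrite -[RHS]e (reindex_onto enum_rank enum_val) /=.
  apply: eq_big => [i|i _]; first by rewrite enum_rankK eqxx.
  by rewrite [M _ _]mxE !enum_rankK.
by move=> i _; rewrite enum_valK.
Qed.

(** Elements of K[t_1, ..., t_k], one more in number than m >= k, are
    algebraically dependent, by counting: with exponents below D there are
    D ^ (m + 1) monomials in f and delta, while they all lie in a space of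
    polynomials of dimension at most (C D) ^ m with C independent of D.  The
    relation is sorted by the powers of delta, the variable which the next
    lemma eliminates. *)
Lemma polynomial_relation k m (f : m.-tuple {mpoly K[k]}) (delta : {mpoly K[k]}) :
  (k <= m)%N ->
  exists D (q : 'I_D -> {mpoly K[m]}), (exists e, q e != 0) /\
    \sum_e (q e \mPo f) * delta ^+ e = 0.
Proof.
move=> le_km; pose c := (\sum_j msize (tnth f j) + msize delta)%N.
have fc j : mdeg_le c (tnth f j).
  apply: mdeg_leW (@mdeg_le_msize _ _); rewrite /c (bigD1 j) //= -addnA; exact: leq_addr.
have dc : mdeg_le c delta by apply: mdeg_leW (@mdeg_le_msize _ _); apply: leq_addl.
(* D exceeds C ^ m, hence (C D) ^ m < D ^ (m + 1) *)
pose C := (m.+1 * c).+1; pose D := (C ^ m).+1; pose B := (m.+1 * (D * c))%N.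
pose mon (a : {ffun 'I_m -> 'I_D}) : 'X_{1..m} := [multinom (a i : nat) | i < m].
pose P (a : {ffun 'I_m -> 'I_D} * 'I_D) := ('X_[mon a.1] \mPo f) * delta ^+ a.2.
have PB a : mdeg_le B (P a).
  rewrite /P comp_mpolyX /B mulSn addnC; apply: mdeg_leM.
    rewrite -[X in (X * _)%N]card_ord; apply: mdeg_le_prod => j.
    apply: mdeg_leW (mdeg_leX (fc j)).
    by rewrite leq_mul2r mnmE ltnW ?orbT.
  by apply: mdeg_leW (mdeg_leX dc); rewrite leq_mul2r ltnW ?orbT.
pose col (b : {ffun 'I_k -> 'I_B.+1}) : 'X_{1..k} := [multinom (b i : nat) | i < k].
have lt_rows : (#|{ffun 'I_k -> 'I_B.+1}| < #|{: {ffun 'I_m -> 'I_D} * 'I_D}|)%N.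
  rewrite card_prod !card_ffun !card_ord.
  have leB : (B.+1 <= C * D)%N.
    have -> : B = (m.+1 * c * D)%N by rewrite /B mulnCA mulnC.
    by rewrite [(C * D)%N]mulSn -[X in (X <= _)%N]add1n leq_add2r.
  have le1 : (B.+1 ^ k <= (C * D) ^ m)%N.
    apply: (@leq_trans ((C * D) ^ k)); first by case: (k) => // k'; rewrite leq_exp2r.
    by rewrite leq_pexp2l // muln_gt0.
  apply: leq_ltn_trans le1 _; rewrite expnMn mulnC ltn_pmul2l ?ltnS //.
  by rewrite expn_gt0.
have [u [[a0 e0] u0] uP] := linear_relation (fun a b => (P a)@_(col b)) lt_rows.
exists D, (fun e => \sum_(a : {ffun 'I_m -> 'I_D}) u (a, e) *: 'X_[mon a]); split.
  exists e0; apply: contraNneq u0 => q0.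
  have := congr1 (mcoeff (mon a0)) q0; rewrite mcoeff0 raddf_sum /= (bigD1 a0) //=.
  rewrite mcoeffZ mcoeffX eqxx mulr1 big1 ?addr0 => [->//|a neq_a].
  rewrite mcoeffZ mcoeffX; case: eqP => [/mnmP eq_a|]; last by rewrite mulr0.
  case/eqP: neq_a; apply/ffunP => i; apply/val_inj; have := eq_a i.
  by rewrite !mnmE.
have sumP : \sum_a u a *: P a = 0.
  apply/mpolyP => x; rewrite mcoeff0 raddf_sum /=.
  have [/existsP[i x_gt]|/existsPn x_le] := boolP [exists i, B < x i]%N.
    rewrite big1 // => a _; rewrite mcoeffZ memN_msupp_eq0 ?mulr0 //.
    apply/negP => /PB; rewrite leqNgt => /negP; apply; apply: (leq_trans x_gt).
    by rewrite mdegE (bigD1 i) //= leq_addr.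
  pose b : {ffun 'I_k -> 'I_B.+1} := [ffun i => inord (x i)].
  have xb : x = col b.
    by apply/mnmP => i; rewrite mnmE ffunE inordK // ltnS leqNgt x_le.
  rewrite -[RHS](uP b) xb; apply: eq_bigr => a _; exact: mcoeffZ.
have sum2 : \sum_a u a *: P a = \sum_a \sum_e u (a, e) *: P (a, e).
  by rewrite pair_bigA /=; apply: eq_bigr => -[].
rewrite -[RHS]sumP sum2 exchange_big /=.
apply: eq_bigr => e _; rewrite raddf_sum mulr_suml; apply: eq_bigr => a _ /=.
by rewrite comp_mpolyZ scalerAl.
Qed.

(** The image under f of the hypersurface delta = 0 of a k-dimensional affine
    space is contained in a hypersurface of m-dimensional affine space, k <= m.
    In a relation between f and delta, divide by the highest possible power of
    delta, which K[t] allows because it is a domain; the coefficient of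
    delta ^ 0 is then a nonzero polynomial in f which vanishes with delta. *)
Lemma image_hypersurface k m (f : m.-tuple {mpoly K[k]}) (delta : {mpoly K[k]}) :
  (k <= m)%N -> delta != 0 ->
  exists2 Q : {mpoly K[m]}, Q != 0 &
    forall t, ev delta t = 0 -> ev Q (fun j => ev (tnth f j) t) = 0.
Proof.
move=> le_km d0; have [D [q [[e1 q_e1] rel]]] := polynomial_relation f delta le_km.
have [e0 q_e0 e0_min] := @ord_min _ (fun e => q e != 0) _ q_e1.
exists (q e0) => // t dt.
pose r := \sum_(e | e != e0) (q e \mPo f) * delta ^+ (e - e0).
have fac : (q e0 \mPo f) + r = 0.
  apply: (mulIf (expf_neq0 e0 d0)); rewrite mul0r -[RHS]rel mulrDl (bigD1 e0) //=.
  congr (_ + _); rewrite mulr_suml; apply: eq_bigr => e _.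
  have [->|/e0_min le_e0] := eqVneq (q e) 0; first by rewrite comp_mpoly0 !mul0r.
  by rewrite -mulrA -exprD subnK.
rewrite -ev_comp; have := congr1 (fun p => ev p t) fac.
rewrite evD ev0; suff -> : ev r t = 0 by rewrite addr0.
apply: (big_ind (fun p => ev p t = 0)) => [|p p' p0 p'0|e neq_e].
- exact: ev0.
- by rewrite evD p0 p'0 addr0.
have [le_e|lt_e] := leqP e e0; last first.
  by rewrite -subn_gt0 in lt_e; rewrite -(prednK lt_e) exprS !evM dt mul0r mulr0.
have -> : q e = 0.
  apply/eqP; apply: contraNT neq_e => /e0_min le_e0.
  by apply/eqP/val_inj/eqP; rewrite eqn_leq le_e.
by rewrite comp_mpoly0 mul0r ev0.
Qed.

End PolynomialFunctions.

(** * Permutations compared by their rank matrices *)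

Section PermutationRank.

Variable n : nat.
Implicit Types u v : 'S_n.

(** Rank of the upper left i x j submatrix of the permutation matrix with a 1
    at each (a, u a). *)
Definition perm_rank u (i j : nat) := #|[set a : 'I_n | (a < i)%N && (u a < j)%N]|.

Definition inversions u := [set p : 'I_n * 'I_n | (p.1 < p.2)%N && (u p.2 < u p.1)%N].

(** Exchanging the two values of an inversion (c, c') loses this inversion,
    and phi embeds the inversions which remain among the others of u. *)
Lemma inversions_swap u (c c' : 'I_n) : (c < c')%N -> (u c' < u c)%N ->
  (#|inversions (tperm c c' * u)| < #|inversions u|)%N.
Proof.
move=> lt_cc' lt_u; set t := tperm c c'.
have neq_cc' : c != c' by apply: contraTneq lt_cc' => ->; rewrite ltnn.
pose phi (p : 'I_n * 'I_n) := if (t p.1 < t p.2)%N then (t p.1, t p.2) else p.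
have cc'_in : (c, c') \in inversions u by rewrite inE lt_cc'.
rewrite [ltnRHS](cardsD1 (c, c')) cc'_in add1n ltnS -(card_in_imset (f := phi)).
  apply/subset_leq_card/subsetP => q /imsetP[[a b]]; rewrite inE /= !permM => /andP[lt_ab lt_uab] ->.
  rewrite /phi /= !inE; case: ifP => lt_tab /=.
    rewrite lt_tab lt_uab !andbT; apply: contraTneq lt_ab => -[ta tb].
    by rewrite -(tpermK c c' a) -(tpermK c c' b) -/t ta tb tpermL tpermR -leqNgt ltnW.
  rewrite lt_ab /=; move: lt_tab lt_uab lt_ab; rewrite /t.
  rewrite xpair_eqE -!val_eqE /=.
  case: tpermP => [->|->|/eqP + /eqP]; case: tpermP => [->|->|/eqP + /eqP]; rewrite -?val_eqE /=; lia.
move=> [a b] [a' b']; rewrite !inE /= => /andP[lt_ab _] /andP[lt_ab' _].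
rewrite /phi /=; case: ifP => lt_t; case: ifP => lt_t' // [].
- by move=> /perm_inj-> /perm_inj->.
- by move=> ea eb; move: lt_t'; rewrite -ea -eb /t !tpermK lt_ab.
- by move=> ea eb; move: lt_t; rewrite ea eb /t !tpermK lt_ab'.
Qed.

(** One step up in Bruhat order.  Let c be the first row where u and v differ;
    the rank inequalities force v c < u c.  Swap u c with the first later value
    that lies in the interval from v c to u c.  Only the ranks in a box of
    positions grow, by one; between the two swapped rows u takes no value of
    that interval, so in the box the rank of u was strictly below that of v. *)
Lemma inversions_step u v : u != v ->
  (forall i j, perm_rank u i j <= perm_rank v i j)%N ->
  exists u', (#|inversions u'| < #|inversions u|)%N /\
    (forall i j, perm_rank u' i j <= perm_rank v i j)%N.
Proof.
move=> neq_uv le_uv.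
have /existsP[c0 c0P] : [exists c, u c != v c].
  apply: contraNT neq_uv => /existsPn eq_uv; apply/eqP/permP => x.
  by apply/eqP; have := eq_uv x; rewrite negbK.
have [c uc_vc c_min] := @ord_min _ (fun c => u c != v c) _ c0P.
have before (a : 'I_n) : (a < c)%N -> u a = v a.
  by move=> lt_ac; apply/eqP; apply: contraTT lt_ac => /c_min; rewrite -leqNgt.
have lt_c : (v c < u c)%N.
  rewrite ltn_neqAle eq_sym val_eqE uc_vc /= leqNgt; apply/negP => gt_c.
  have := le_uv c.+1 (u c).+1; rewrite leqNgt => /negP; apply.
  apply/proper_card/properP; split; last by exists c; rewrite !inE ?ltnSn //= ltnS -ltnNge.
  apply/subsetP => a; rewrite !inE !ltnS [(a <= c)%N]leq_eqVlt => /andP[/orP[/eqP/val_inj->|lt_ac]].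
    by rewrite leqNgt gt_c.
  by rewrite (before a lt_ac) lt_ac orbT.
pose between (a : 'I_n) := [&& c < a, v c <= u a & u a < u c]%N.
have between0 : between (u^-1 (v c))%g.
  rewrite /between permKV leqnn lt_c !andbT ltnNge leq_eqVlt; apply/negP => /orP[/eqP/val_inj e|lt].
    by have := lt_c; rewrite -{2}e permKV ltnn.
  by have := before _ lt; rewrite permKV => /perm_inj e; rewrite -e ltnn in lt.
have [c' /and3P[lt_cc' le_c' lt_c'] c'_min] := ord_min between0.
exists (tperm c c' * u)%g; split; first exact: inversions_swap.
move=> i j; have [/and4P[ci ic' c'j jc]|no_box] := boolP [&& c < i, i <= c', u c' < j & j <= u c]%N.
  apply: (@leq_trans (perm_rank u i j).+1).
    rewrite -add1n -(cards1 c); apply: leq_trans (leq_card_setU _ _).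
    apply/subset_leq_card/subsetP => a; rewrite !inE permM.
    case: tpermP => [->|->|_ _]; rewrite ?eqxx //=; lia.
  (* split the columns at v c: the two rank functions are compared on each side *)
  have split_rank w : perm_rank w i j =
      (perm_rank w i (v c) + #|[set a : 'I_n | (a < i) && (v c <= w a < j)]|)%N.
    rewrite /perm_rank -(cardsID [set a : 'I_n | (w a < v c)%N]); congr addn;
      apply: eq_card => a; rewrite !inE; have := lt_c; lia.
  rewrite !split_rank -addnS leq_add //; apply/proper_card/properP; split; last first.
    by exists c; rewrite !inE; lia.
  apply/subsetP => a; rewrite !inE => /andP[ai /andP[va aj]].
  have lt_ac : (a < c)%N.
    rewrite ltnNge; apply/negP => le_ca; have neq_ac : c != a.
      by apply: contraTneq aj => <-; rewrite -leqNgt.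
    suff /c'_min : between a by move=> /= c'a; move: (leq_trans ai ic'); rewrite ltnNge c'a.
    rewrite /between va (leq_trans aj jc) ltn_neqAle le_ca andbT.
    by rewrite -val_eqE in neq_ac; rewrite neq_ac.
  by rewrite ai -(before a lt_ac) va.
apply: leq_trans (le_uv i j); rewrite /perm_rank.
have [same|diff] := boolP ((c < i)%N == (c' < i)%N).
  rewrite -[leqRHS](card_imset _ (@perm_inj _ (tperm c c'))).
  apply/subset_leq_card/subsetP => a; rewrite inE permM => /andP[ai aj].
  apply/imsetP; exists (tperm c c' a); last by rewrite tpermK.
  rewrite inE aj andbT; case: tpermP aj ai => [->|->|] //; by rewrite (eqP same).
apply/subset_leq_card/subsetP => a; rewrite !inE permM.
move: no_box diff; case: tpermP => [->|->|_ _ _ _]; lia.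
Qed.

(** Larger ranks mean strictly fewer inversions, unless the permutations are
    equal.  In geometric terms: a Schubert cell contained in a Schubert variety
    is its open cell or has smaller dimension. *)
Lemma inversions_rank_lt u v :
  (forall i j, perm_rank u i j <= perm_rank v i j)%N ->
  u = v \/ (#|inversions v| < #|inversions u|)%N.
Proof.
have [k] := ubnP #|inversions u|; elim: k u => // k IH u; rewrite ltnS => le_k le_uv.
have [->|neq_uv] := eqVneq u v; [by left | right].
have [u' [lt_u' /IH]] := inversions_step neq_uv le_uv.
case=> [|<- //|lt_v]; first exact: leq_trans lt_u' le_k.
exact: ltn_trans lt_v lt_u'.
Qed.

Lemma card_ord_lt k : (k <= n)%N -> #|[set b : 'I_n | (b < k)%N]| = k.
Proof.
move=> le_kn; rewrite -[RHS]card_ord -(card_imset (mem 'I_k) (f := widen_ord le_kn)).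
  apply: eq_card => i; rewrite inE; apply/idP/imsetP => [ik|[i' _ ->]]; last exact: (ltn_ord i').
  by exists (Ordinal ik) => //; apply/val_inj.
by move=> a b e; apply/val_inj/(congr1 val e).
Qed.

Lemma card_lt_pairs : #|[set p : 'I_n * 'I_n | (p.1 < p.2)%N]| = 'C(n, 2).
Proof.
rewrite -sum1_card (eq_bigl (fun p : 'I_n * 'I_n => true && (p.1 < p.2)%N)).
  rewrite -(pair_big_dep xpredT (fun i j : 'I_n => (i < j)%N) (fun _ _ => 1%N)) /=.
  rewrite -bin2_sum (exchange_big_dep xpredT) //= [RHS]big_mkord.
  apply: eq_bigr => j _; rewrite sum1_card -[RHS](card_ord_lt (ltnW (ltn_ord j))).
  by apply: eq_card => i; rewrite inE.
by move=> p; rewrite inE.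
Qed.

(** Only the order-reversing permutation has all pairs as inversions. *)
Lemma inversions_max_inj u v :
  #|inversions u| = 'C(n, 2) -> #|inversions v| = 'C(n, 2) -> u = v.
Proof.
suff val_u w : #|inversions w| = 'C(n, 2) ->
    forall a : 'I_n, w a = #|[set b : 'I_n | (a < b)%N]| :> nat.
  by move=> /val_u eu /val_u ev; apply/permP => a; apply/val_inj; rewrite [LHS]eu -ev.
move=> full; have decr (a b : 'I_n) : (w b < w a)%N = (a < b)%N.
  have sub : inversions w \subset [set p : 'I_n * 'I_n | (p.1 < p.2)%N].
    by apply/subsetP => p; rewrite !inE => /andP[].
  have /setP e : inversions w = [set p : 'I_n * 'I_n | (p.1 < p.2)%N].
    by apply/eqP; rewrite eqEcard sub full card_lt_pairs /=.
  have lt_decr (x y : 'I_n) : (x < y)%N -> (w y < w x)%N.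
    by move=> xy; have := e (x, y); rewrite !inE /= xy /= => ->.
  case: (ltngtP a b) => [/lt_decr //|/lt_decr lt|/val_inj ->]; last by rewrite ltnn.
  by rewrite ltnNge ltnW.
move=> a; have -> : nat_of_ord (w a) = #|[set c : 'I_n | (c < w a)%N]|.
  by rewrite card_ord_lt // ltnW.
rewrite -(card_imset (mem [set b : 'I_n | (a < b)%N]) (@perm_inj _ w)).
apply: eq_card => c; rewrite inE; apply/idP/imsetP => [cw|[b]]; last by rewrite inE -decr => bw ->.
by exists (w^-1 c)%g; [rewrite inE -decr permKV | rewrite permKV].
Qed.

End PermutationRank.

(** * The permutation of a Schubert condition *)

Section SchubertPermutation.

Variable n : nat.
Implicit Types w u : 'S_n.

(** The matrix attached to w has the 1 of row a in this column: the columns of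
    the Schubert labelling are numbered backwards. *)
Definition relative_position w : 'S_n := (w^-1 * perm rev_ord_inj)%g.

Lemma relative_positionE w a : relative_position w a = rev_ord (w^-1 a)%g.
Proof. by rewrite permM permE. Qed.

Lemma inversions_relative_position w :
  (#|inversions (relative_position w)| + perm_length w = 'C(n, 2))%N.
Proof.
rewrite -card_lt_pairs -[RHS](cardsID [set p : 'I_n * 'I_n | (w p.1 < w p.2)%N]).
congr addn.
  pose f (p : 'I_n * 'I_n) := (w p.1, w p.2).
  have f_inj : injective f by move=> [a b] [c d] [/perm_inj-> /perm_inj->].
  rewrite -[RHS](card_imset _ f_inj); apply: eq_card => -[a b]; rewrite inE /=.
  rewrite !relative_positionE /=; apply/idP/imsetP => [/andP[ab lt]|[[c d]]].
    exists (w^-1 a, w^-1 b)%g; last by rewrite /f !permKV.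
    rewrite !inE !permKV /= ab andbT.
    by have := ltn_ord (w^-1 a)%g; have := ltn_ord (w^-1 b)%g; lia.
  rewrite !inE /= => /andP[cd lt] [-> ->]; rewrite !permK lt /=.
  by have := ltn_ord d; lia.
apply: eq_card => -[a b]; rewrite !inE /=.
case: (ltngtP (w a) (w b)) => //= [||/val_inj/perm_inj ->]; rewrite ?ltnn ?andbT ?andbF //.
Qed.

(** Inversions counted by the matrix positions (row, column) strictly to the
    left of the 1 of their row and strictly above the 1 of their column; these
    are the free entries of the reduced matrices below. *)
Lemma card_inversions u :
  #|[set p : 'I_n * 'I_n | (p.2 < u p.1)%N && (p.1 < u^-1%g p.2)%N]| = #|inversions u|.
Proof.
pose f (p : 'I_n * 'I_n) := (p.1, u p.2).
have f_inj : injective f by move=> [a b] [c d] [-> /perm_inj->].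
rewrite -[RHS](card_imset _ f_inj); apply: eq_card => -[a b]; rewrite inE /=.
apply/idP/imsetP => [/andP[lt1 lt2]|[[c d]]].
  by exists (a, u^-1 b)%g; rewrite ?inE /= ?lt2 /f /= permKV.
by rewrite inE /= => /andP[lt1 lt2] [-> ->]; rewrite permK lt1 lt2.
Qed.

(** The rows which have their 1 inside the submatrix are orthonormal. *)
Lemma rank_upper_left (L : fieldType) w (i j : 'I_n) :
  (perm_rank (relative_position w) i.+1 j.+1 <= \rank (upper_left L w i j))%N.
Proof.
rewrite /perm_rank; set P := [set a | _]; pose A := upper_left L w i j.
pose f (k : 'I_#|P|) : 'I_i.+1 := inord (enum_val k).
have fE k : widen_ord (ltn_ord i) (f k) = enum_val k.
  apply/val_inj; rewrite /= inordK //.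
  by have := enum_valP k; rewrite inE => /andP[].
have one : rowsub f A *m (rowsub f A)^T = 1%:M.
  apply/matrixP => a b; rewrite !mxE.
  have := enum_valP a; rewrite inE => /andP[_]; set c := relative_position w _ => cj.
  rewrite (bigD1 (Ordinal cj)) //= big1 ?addr0 => [|c' neq_c'].
    rewrite !mxE !fE.
    have -> : rev_ord (widen_ord (ltn_ord j) (Ordinal cj)) = (w^-1 (enum_val a))%g.
      rewrite -[RHS]rev_ordK -relative_positionE; congr rev_ord; exact: val_inj.
    by rewrite permKV eqxx mul1r (inj_eq enum_val_inj) eq_sym.
  rewrite !mxE !fE; case: eqP => [e|]; last by rewrite mul0r.
  case/eqP: neq_c'; apply/val_inj; rewrite /= /c relative_positionE e permK.
  by rewrite rev_ordK.
have full : row_free (rowsub f A) by apply/row_freeP; exists (rowsub f A)^T.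
rewrite -(eqP full); exact: mxrankS (rowsub_sub f A).
Qed.

End SchubertPermutation.

(** * Flags in coordinates *)

Section FlagCoordinates.

Variables (L : fieldType) (n : nat).
Implicit Types (F : flag L n) (g h : 'M[L]_n) (v : 'rV[L]_n) (k : 'I_n).

(** The space of dimension k, for k : 'I_n, whereas flag_at has dimension k + 1:
    flag_below F k is the hyperplane of flag_at F k that precedes it. *)
Definition flag_below F k : {vspace 'rV[L]_n} := F (widen_ord (leqnSn n) k).

Lemma flag_below_at F k : (flag_below F k <= flag_at F k)%VS.
Proof. by apply: flag_mono; rewrite /= /bump leqnSn. Qed.

Lemma dim_flag_at F k : \dim (flag_at F k) = k.+1.
Proof. by rewrite /flag_at flag_dim. Qed.

Lemma dim_flag_below F k : \dim (flag_below F k) = k.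
Proof. by rewrite /flag_below flag_dim. Qed.

Lemma flag_at_below F (k k' : 'I_n) : (k < k')%N -> (flag_at F k <= flag_below F k')%VS.
Proof. by move=> lt_kk'; apply: flag_mono. Qed.

Lemma flag_at_le F (k k' : 'I_n) : (k <= k')%N -> (flag_at F k <= flag_at F k')%VS.
Proof. by move=> le_kk'; apply: flag_mono. Qed.

Definition adapted g F :=
  forall k, row k g \in flag_at F k /\ row k g \notin flag_below F k.

Definition row_span g (i : nat) : {vspace 'rV[L]_n} :=
  <<[seq row k g | k : 'I_n <- enum 'I_n & (k < i)%N]>>%VS.

Lemma mem_row_span g k (i : nat) : (k < i)%N -> row k g \in row_span g i.
Proof. by move=> lt_ki; apply/memv_span/map_f; rewrite mem_filter lt_ki mem_enum. Qed.

Lemma row_span_subvP g (i : nat) (W : {vspace 'rV[L]_n}) :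
  reflect (forall k, (k < i)%N -> row k g \in W) (row_span g i <= W)%VS.
Proof.
apply: (iffP span_subvP) => [sub k lt_ki|sub _ /mapP[k + ->]]; last first.
  by rewrite mem_filter => /andP[/sub].
by apply/sub/map_f; rewrite mem_filter lt_ki mem_enum.
Qed.

Lemma row_spanS g (i j : nat) : (i <= j)%N -> (row_span g i <= row_span g j)%VS.
Proof.
by move=> le_ij; apply/row_span_subvP => k lt_ki; apply/mem_row_span/(leq_trans lt_ki).
Qed.

Lemma row_span_full g : row_span g n = fullv -> g \in unitmx.
Proof.
move=> full; rewrite -row_full_unit -sub1mx; apply/row_subP => c.
have sub : (row_span g n <= limg (linfun (mulmxr g : 'rV_n -> 'rV_n)))%VS.
  apply/row_span_subvP => k _; apply/memv_imgP; exists (row k 1%:M); first exact: memvf.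
  by rewrite lfunE /= -row_mul mul1mx.
have /memv_imgP[u _ ->] : row c 1%:M \in limg (linfun (mulmxr g : 'rV_n -> 'rV_n)).
  by apply: (subvP sub); rewrite full memvf.
by rewrite lfunE submxMl.
Qed.

(** Row v *m invmx g holds the coordinates of v in the basis of rows of g. *)
Lemma mem_row_spanP g (i : nat) v : g \in unitmx ->
  reflect (forall c : 'I_n, (i <= c)%N -> (v *m invmx g) 0 c = 0) (v \in row_span g i).
Proof.
move=> g_unit; apply: (iffP idP) => [v_in c le_ic|v0]; last first.
  rewrite -[v](mulmxKV g_unit) mulmx_sum_row; apply: memv_suml => c _.
  have [/v0->|lt_ci] := leqP i c; first by rewrite scale0r mem0v.
  exact/memvZ/mem_row_span.
pose f := linfun (mulmxr (col c (invmx g)) : 'rV_n -> 'rV_1).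
have fE u : f u = col c (u *m invmx g) by rewrite lfunE /= !colE mulmxA.
have /subvP/(_ _ v_in) : (row_span g i <= lker f)%VS.
  apply/row_span_subvP => k lt_ki; rewrite memv_ker fE -row_mul mulmxV //.
  apply/eqP/rowP => z; rewrite !mxE; case: eqP => // e.
  by rewrite e ltnNge le_ic in lt_ki.
by rewrite memv_ker fE => /eqP/rowP/(_ 0); rewrite !mxE.
Qed.

Lemma dim_row_span g (i : nat) : g \in unitmx -> (i <= n)%N -> \dim (row_span g i) = i.
Proof.
move=> g_unit le_in; pose X := [seq row k g | k : 'I_n <- enum 'I_n].
have fullX : <<X>>%VS = fullv.
  apply/eqP; rewrite eqEsubv subvf /=; apply/subvP => v _.
  have -> : X = [seq row k g | k : 'I_n <- enum 'I_n & (k < n)%N].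
    by congr map; rewrite -[LHS]filter_predT; apply: eq_filter => k; rewrite ltn_ord.
  by apply/mem_row_spanP => // c; rewrite leqNgt ltn_ord.
have freeX : free X.
  rewrite /free fullX dimvf /X size_map size_enum_ord.
  by rewrite /dim /= mul1n.
have : free [seq row k g | k : 'I_n <- enum 'I_n & (k < i)%N].
  have : perm_eq (map (fun k => row k g) ([seq k : 'I_n <- enum 'I_n | (k < i)%N] ++
      [seq k : 'I_n <- enum 'I_n | predC (fun k : 'I_n => (k < i)%N) k])) X.
    by apply/perm_map/permPl; apply: perm_filterC.
  by move/perm_free; rewrite freeX map_cat => /catl_free.
move/eqP => ->; rewrite size_map size_filter -[RHS](card_ord_lt le_in).
by rewrite -sum1_count big_enum_cond -sum1_card; apply: eq_bigl => k; rewrite inE.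
Qed.

Lemma row_notin_span g k : g \in unitmx -> row k g \notin row_span g k.
Proof.
move=> g_unit; apply/mem_row_spanP => // /(_ k (leqnn k)).
by rewrite -row_mul mulmxV // !mxE eqxx => /eqP; rewrite oner_eq0.
Qed.

Lemma represents_unit g F : represents g F -> g \in unitmx.
Proof.
move=> gF; apply: row_span_full; apply/eqP; rewrite eqEdim subvf /=.
have := gF ord_max; rewrite -/(row_span g n) => <-.
by rewrite flag_dim dimvf /dim /= mul1n.
Qed.

Lemma represents_adapted g F : represents g F -> adapted g F.
Proof.
move=> gF k; have g_unit := represents_unit gF.
rewrite /flag_at /flag_below !gF -!/(row_span g _); split.
  exact/mem_row_span.
exact: row_notin_span.
Qed.

Lemma adapted_represents g F : adapted g F -> represents g F.
Proof.
move=> gF [i lt_in]; rewrite -/(row_span g i).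
elim: i lt_in => [|i IH] lt_in.
  apply/eqP; rewrite eq_sym eqEdim flag_dim leq0n andbT.
  by apply/row_span_subvP.
have lt_in' : (i < n)%N by [].
have [in_at notin_below] := gF (Ordinal lt_in').
have eq_at : F (Ordinal lt_in) = flag_at F (Ordinal lt_in').
  by congr (flag_space F _); apply/val_inj.
have below : flag_below F (Ordinal lt_in') = row_span g i.
  rewrite -(IH (leqW lt_in')); congr (flag_space F _); exact/val_inj.
apply/eqP; rewrite eq_sym eqEdim eq_at; apply/andP; split.
  apply/row_span_subvP => k; rewrite ltnS => le_ki.
  exact: (subvP (flag_at_le F (le_ki : (k <= Ordinal lt_in')%N))) (proj1 (gF k)).
rewrite dim_flag_at ltnNge; apply: contra notin_below => le_dim.
have : row_span g i == row_span g i.+1.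
  by rewrite eqEdim row_spanS //= -below dim_flag_below.
by move/eqP => e; rewrite below e mem_row_span.
Qed.

Lemma exists_adapted_vector F : forall k, exists2 v, v \in flag_at F k & v \notin flag_below F k.
Proof.
move=> k; apply/subvPn; apply/negP => /dimvS.
by rewrite dim_flag_at dim_flag_below ltnn.
Qed.

Lemma exists_represents F : exists g, represents g F.
Proof.
have /fin_all_exists[r rF] k : exists v, v \in flag_at F k /\ v \notin flag_below F k.
  by have [v v1 v2] := exists_adapted_vector F k; exists v.
exists (\matrix_k r k); apply: adapted_represents => k; rewrite rowK; exact: rF.
Qed.

Lemma mem_flag_atP g F k v : represents g F ->
  reflect (forall c : 'I_n, (k < c)%N -> (v *m invmx g) 0 c = 0) (v \in flag_at F k).
Proof.
by move=> gF; rewrite /flag_at gF; apply: mem_row_spanP; apply: represents_unit gF.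
Qed.

Lemma mem_flag_belowP g F k v : represents g F ->
  reflect (forall c : 'I_n, (k <= c)%N -> (v *m invmx g) 0 c = 0) (v \in flag_below F k).
Proof.
by move=> gF; rewrite /flag_below gF; apply: mem_row_spanP; apply: represents_unit gF.
Qed.

Lemma exists_flag g : g \in unitmx -> exists F, represents g F.
Proof.
move=> g_unit; pose f := [ffun i : 'I_n.+1 => row_span g i].
have f_dim i : \dim (f i) = i by rewrite ffunE dim_row_span // -ltnS.
have f_mono (i j : 'I_n.+1) : (i <= j)%N -> (f i <= f j)%VS.
  by move=> le_ij; rewrite !ffunE; apply: row_spanS.
by exists (Flag f_dim f_mono) => i; rewrite /= ffunE.
Qed.

Lemma represents_lower_mul g F (l : 'M[L]_n) :
  (forall a c : 'I_n, (a < c)%N -> l a c = 0) -> (forall a, l a a != 0) ->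
  represents g F -> represents (l *m g) F.
Proof.
move=> l_low l_diag gF; have g_unit := represents_unit gF.
have coord a c : (row a (l *m g) *m invmx g) 0 c = l a c.
  by rewrite row_mul mulmxK // mxE.
apply: adapted_represents => a; split.
  by apply/(mem_flag_atP _ _ gF) => c lt_ac; rewrite coord l_low.
apply/negP => /(mem_flag_belowP _ _ gF)/(_ a (leqnn a)).
by rewrite coord; apply/eqP.
Qed.

Lemma represents_lower g g' F : represents g F -> represents g' F ->
  exists2 l : 'M[L]_n, (forall a c : 'I_n, (a < c)%N -> l a c = 0) & g' = l *m g.
Proof.
move=> gF g'F; have g_unit := represents_unit gF.
exists (g' *m invmx g); last by rewrite mulmxKV.
move=> a c lt_ac; have [/(mem_flag_atP _ _ gF)/(_ c lt_ac) + _] := represents_adapted g'F a.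
by rewrite -row_mul mxE.
Qed.

End FlagCoordinates.

(** * The permutation array of a family of flags *)

Section VectorPositions.

Variables (L : fieldType) (n : nat).
Implicit Types (F : flag L n) (v : 'rV[L]_n) (W : {vspace 'rV[L]_n}) (k : 'I_n).

(** k is the step at which v enters the flag. *)
Definition at_pos F v k := (v \in flag_at F k) && (v \notin flag_below F k).

Lemma at_pos_flag_at F v k c : at_pos F v k -> (v \in flag_at F c) = (k <= c)%N.
Proof.
case/andP=> v_at v_below; apply/idP/idP => [vc|le_kc].
  rewrite leqNgt; apply: contra v_below => lt_ck.
  exact: (subvP (flag_at_below F lt_ck)).
exact: (subvP (flag_at_le F le_kc)).
Qed.

Lemma at_pos_flag_below F v k c : at_pos F v k -> (v \in flag_below F c) = (k < c)%N.
Proof.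
case/andP=> v_at v_below; apply/idP/idP => [vc|lt_kc].
  rewrite ltnNge; apply: contra v_below => le_ck.
  by apply: (subvP _ _ vc); apply: flag_mono.
exact: (subvP (flag_at_below F lt_kc)).
Qed.

Lemma at_pos_exists F v : v != 0 -> exists k, at_pos F v k.
Proof.
move=> v_neq0; have [g gF] := exists_represents F.
pose x := v *m invmx g; have x_neq0 : x != 0.
  apply: contraNneq v_neq0 => x0.
  by rewrite -[v](mulmxKV (represents_unit gF)) -/x x0 mul0mx.
have /rV0Pn[c0 c0P] := x_neq0.
case: (@arg_maxnP _ c0 (fun c => x 0 c != 0) val c0P) => k xk k_max; exists k.
apply/andP; split.
  apply/(mem_flag_atP _ _ gF) => c lt_kc; apply/eqP; apply: contraTT lt_kc => /k_max.
  by rewrite -leqNgt.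
by apply/negP => /(mem_flag_belowP _ _ gF)/(_ k (leqnn k)); apply/eqP.
Qed.

(** Consecutive spaces of a flag differ by one dimension, so two vectors that
    enter at the same step are proportional modulo the previous space. *)
Lemma at_pos_cancel F v w k : at_pos F v k -> at_pos F w k ->
  exists c, v - c *: w \in flag_below F k.
Proof.
move=> /andP[v_at _] /andP[w_at w_below]; have [g gF] := exists_represents F.
have wk : (w *m invmx g) 0 k != 0.
  apply: contra w_below => /eqP wk; apply/(mem_flag_belowP _ _ gF) => c.
  rewrite leq_eqVlt => /orP[/eqP/val_inj <- //|lt_kc].
  exact: (mem_flag_atP _ _ gF w_at).
exists ((v *m invmx g) 0 k / (w *m invmx g) 0 k).
apply/(mem_flag_belowP _ _ gF) => c; rewrite leq_eqVlt mulmxBl -scalemxAl.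
rewrite [LHS]mxE [X in _ + X]mxE [X in _ - X]mxE.
case/orP=> [/eqP/val_inj <-|lt_kc]; first by rewrite divfK ?subrr.
by rewrite !(mem_flag_atP _ _ gF _ c lt_kc) // mulr0 subr0.
Qed.

(** The dimension of W is the number of steps at which W meets F in something
    new, since each step adds at most one dimension. *)
Lemma dim_positions W F :
  \dim W = #|[set k | ~~ (W :&: flag_at F k <= flag_below F k)%VS]|.
Proof.
set J := [set k | _].
suff step (i : 'I_n.+1) : \dim (W :&: F i) = #|[set k in J | (k < i)%N]|.
  have := step ord_max; rewrite (_ : F ord_max = fullv) ?capvf => [->|].
    by apply: eq_card => k; rewrite in_set /= ltn_ord andbT.
  by apply/eqP; rewrite eqEdim subvf flag_dim dimvf /dim /= mul1n.
case: i => i; elim: i => [|i IH] lt_in.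
  rewrite (_ : [set k in J | (k < 0)%N] = set0); last by apply/setP => k; rewrite !inE andbF.
  apply/eqP; rewrite cards0 -leqn0 -[X in (_ <= X)%N](flag_dim F (Ordinal lt_in)).
  by rewrite dimvS ?capvSr.
have lt_in' : (i < n)%N by []; pose k := Ordinal lt_in'.
have -> : F (Ordinal lt_in) = flag_at F k by congr (flag_space F _); apply/val_inj.
have := IH (leqW lt_in'); set b := F _.
have -> : b = flag_below F k by congr (flag_space F _); apply/val_inj.
have capE : (W :&: flag_at F k :&: flag_below F k = W :&: flag_below F k)%VS.
  by rewrite -capvA (capv_idPr (flag_below_at F k)).
have [kJ|kJ] := boolP (k \in J); last first.
  rewrite inE negbK in kJ.
  rewrite -capE (capv_idPl kJ) => ->; apply: eq_card => c; rewrite !in_set /=.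
  have [->|] := eqVneq c k; first by rewrite kJ.
  by rewrite -val_eqE /= => ck; rewrite ltnS [(c <= i)%N]leq_eqVlt (negPf ck).
have -> : [set c in J | (c < i.+1)%N] = k |: [set c in J | (c < i)%N].
  apply/setP => c; rewrite in_setU1 !in_set; rewrite in_set in kJ.
  have [->|] := eqVneq c k; first by rewrite kJ /= ltnSn.
  by rewrite -val_eqE /= => ck; rewrite ltnS [(c <= i)%N]leq_eqVlt (negPf ck).
rewrite cardsU1 !inE ltnn andbF /= => <-.
have := dimv_sum_cap (W :&: flag_at F k) (flag_below F k); rewrite capE dim_flag_below.
have : (\dim ((W :&: flag_at F k) + flag_below F k) <= k.+1)%N.
  by rewrite -(dim_flag_at F k) dimvS // subv_add capvSr flag_below_at.
have : (\dim (W :&: flag_below F k) < \dim (W :&: flag_at F k))%N.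
  rewrite inE in kJ; rewrite ltnNge; apply: contra kJ => le_dim.
  have : (W :&: flag_below F k == W :&: flag_at F k)%VS.
    by rewrite eqEdim le_dim capvS ?flag_below_at.
  by move=> /eqP <-; apply: capvSr.
rewrite /=; lia.
Qed.

Lemma positionP W F k :
  reflect (exists2 v, v \in W & at_pos F v k) (~~ (W :&: flag_at F k <= flag_below F k)%VS).
Proof.
apply: (iffP idP) => [/subvPn[v /memv_capP[vW v_at] v_below]|[v vW /andP[v_at v_below]]].
  by exists v => //; apply/andP.
by apply/subvPn; exists v => //; apply/memv_capP.
Qed.

End VectorPositions.

Section ArrayOfFlags.

Variables (L : fieldType) (m n : nat) (G : 'I_m -> flag L n).
Implicit Types (x y : position m n) (v : 'rV[L]_n).

Definition flag_meet x : {vspace 'rV[L]_n} := (\bigcap_j flag_at (G j) (x j))%VS.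

Lemma mem_flag_meetP x v : reflect (forall j, v \in flag_at (G j) (x j)) (v \in flag_meet x).
Proof.
by apply: (iffP subv_bigcapP) => [h j|h j _]; apply: h.
Qed.

Definition vector_pos v x := forall j, at_pos (G j) v (x j).

Definition attained x := exists v, vector_pos v x.

(** Attained positions below which no other one shares a coordinate.  Since y
    below x with a common coordinate makes x redundant through the pair of x
    and y, only these positions can be in a permutation array; they are kept
    all. *)
Definition minimal_attained x :=
  attained x /\ forall y, attained y -> pos_le y x -> (exists i, y i = x i) -> y = x.

Definition flag_array : {set position m n} :=
  [set x | if excluded_middle_informative (minimal_attained x) then true else false].

Lemma flag_arrayP x : reflect (minimal_attained x) (x \in flag_array).
Proof. by rewrite inE; case: excluded_middle_informative => h; constructor. Qed.

Lemma vector_pos_exists v : v != 0 -> exists x, vector_pos v x.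
Proof.
move=> v_neq0; have /fin_all_exists[f fP] j := at_pos_exists (G j) v_neq0.
by exists [ffun j => f j] => j; rewrite ffunE.
Qed.

Lemma vector_pos_le v x y : vector_pos v y -> pos_le y x = (v \in flag_meet x).
Proof.
move=> vy; apply/forallP/mem_flag_meetP => h j; first by rewrite (at_pos_flag_at _ (vy j)).
by rewrite -(at_pos_flag_at _ (vy j)).
Qed.

(** If x, attained by v, is not minimal because of y, attained by w, then for
    any direction j there is a smaller attained position z with z j = x j.
    Either y will do, or w enters the j-th flag before v does; then subtract
    from v the multiple of w which lowers the i-th coordinate: the j-th one
    does not move. *)
Lemma attained_shrink x y i j : attained x -> attained y ->
  pos_le y x -> y i = x i -> y != x ->
  exists z, [/\ attained z, pos_le z x, z j = x j & z != x].
Proof.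
move=> [v vx] [w wy] le_yx yi neq_yx.
have [yj|neq_yj] := eqVneq (y j) (x j); first by exists y; split=> //; exists w.
have lt_yj : (y j < x j)%N.
  by rewrite ltn_neqAle -val_eqE in neq_yj *; rewrite neq_yj; apply: (forallP le_yx).
have wi : at_pos (G i) w (x i) by rewrite -yi.
have [c uP] := at_pos_cancel (vx i) wi; set u := v - c *: w in uP.
have uj : u \notin flag_below (G j) (x j).
  apply/negP => uB; have := at_pos_flag_below (x j) (vx j); rewrite ltnn.
  rewrite -[v](subrK (c *: w)) memvD // memvZ // (at_pos_flag_below _ (wy j)).
  exact: lt_yj.
have u_neq0 : u != 0 by apply: contraNneq uj => ->; apply: mem0v.
have [z uz] := vector_pos_exists u_neq0.
have le_zx : pos_le z x.
  rewrite (vector_pos_le _ uz) memvB ?memvZ // -?(vector_pos_le x vx) -?(vector_pos_le x wy) //.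
  exact/forallP.
exists z; split=> //; first by exists u.
  apply/val_inj/eqP; rewrite eqn_leq (forallP le_zx) leqNgt.
  by rewrite -(at_pos_flag_below _ (uz j)).
apply: contraTneq uP => zx; rewrite (at_pos_flag_below _ (uz i)) zx.
by rewrite ltnn.
Qed.

(** Repeated shrinking with j fixed: replacing the attained positions by the
    minimal ones leaves all ranks unchanged. *)
Lemma minimal_below x j : attained x ->
  exists y, [/\ minimal_attained y, pos_le y x & y j = x j].
Proof.
have [k] := ubnP (\sum_i x i)%N; elim: k x => // k IH x; rewrite ltnS => le_k x_att.
have [x_min|x_nmin] := classic (minimal_attained x).
  by exists x; split=> //; apply/forallP.
have [y [y_att le_yx [i yi] neq_yx]] :
    exists y, [/\ attained y, pos_le y x, exists i, y i = x i & y <> x].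
  apply: NNPP => no_y; apply: x_nmin; split=> // y y_att le_yx yi.
  by apply: NNPP => neq_yx; apply: no_y; exists y.
have [z [z_att le_zx zj neq_zx]] :=
  attained_shrink j x_att y_att le_yx yi (introN eqP neq_yx).
have lt_zx : (\sum_i z i < \sum_i x i)%N.
  rewrite ltnNge; apply: contra neq_zx => le_sum; apply/eqP/ffunP => i'; apply/val_inj.
  exact: (sum_leq_eq (fun a => forallP le_zx a) le_sum).
have [y' [y'_min le_y'z y'j]] := IH z (leq_trans lt_zx le_k) z_att.
exists y'; split=> //; last by rewrite y'j.
by apply/forallP => a; apply: leq_trans (forallP le_y'z a) (forallP le_zx a).
Qed.

(** Every nonzero vector of the meet is at a position below x, and conversely;
    so the values of the j-th coordinate on the positions attained below x are
    the steps counted by dim_positions for the j-th flag. *)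
Lemma flag_array_rank x : has_rank (below flag_array x) (\dim (flag_meet x)).
Proof.
move=> j; rewrite (dim_positions _ (G j)); apply: eq_card => k; rewrite !inE.
apply/existsP/positionP => [[y /andP[+ /eqP <-]]|[v v_in vk]].
  rewrite inE => /andP[/flag_arrayP[[v vy] _] le_yx]; exists v; last exact: vy.
  by rewrite -(vector_pos_le _ vy).
have v_neq0 : v != 0.
  by apply: contraTneq vk => ->; rewrite /at_pos !mem0v.
have [y vy] := vector_pos_exists v_neq0.
have yj : y j = k.
  apply/val_inj/eqP; rewrite eqn_leq -(at_pos_flag_at _ (vy j)) -(at_pos_flag_at _ vk).
  by case/andP: vk (vy j) => -> _ /andP[].
have [z [z_min le_zy zj]] := minimal_below j (ex_intro _ v vy : attained y).
exists z; rewrite inE zj yj eqxx andbT; apply/andP; split; first exact/flag_arrayP.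
have le_yx : pos_le y x by rewrite (vector_pos_le _ vy).
by apply/forallP => a; apply: leq_trans (forallP le_zy a) (forallP le_yx a).
Qed.

Lemma flag_array_permutation : permutation_array flag_array.
Proof.
split=> [x|j|x /flag_arrayP[_ x_min] [R [sub_R join_R lt_R R_share]]].
- by exists (\dim (flag_meet x)); apply: flag_array_rank.
- have [n0|n_gt0] := posnP n.
    have no_ord : 'I_n -> False by move=> k; have := ltn_ord k; rewrite [X in (_ < X)%N]n0.
    by rewrite [RHS]n0; apply: eq_card0 => k; case: (no_ord k).
  have lt_top : (n.-1 < n)%N by rewrite prednK.
  pose top : position m n := [ffun=> Ordinal lt_top].
  have in_top y : pos_le y top.
    by apply/forallP => i; rewrite ffunE /= -ltnS prednK.
  have -> : flag_array = below flag_array top by apply/setP => y; rewrite [RHS]in_set in_top andbT.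
  rewrite flag_array_rank (_ : flag_meet top = fullv) ?dimvf /dim /= ?mul1n //.
  apply/eqP; rewrite eqEsubv subvf; apply/subv_bigcapP => i _.
  suff -> : flag_at (G i) (top i) = fullv by [].
  by apply/eqP; rewrite eqEdim subvf dim_flag_at dimvf ffunE /= prednK // /dim /= mul1n.
have [y yR neq_yx] : exists2 y, y \in R & y != x.
  apply/exists_inP; apply: contraTT lt_R => /exists_inPn all_x.
  rewrite -leqNgt -(cards1 x); apply/subset_leq_card/subsetP => y /all_x.
  by rewrite negbK inE.
case/eqP: neq_yx; apply: x_min; last exact: R_share.
  by have /flag_arrayP[] := subsetP sub_R y yR.
by apply/forallP => i; rewrite join_R (bigD1 y) //= leq_maxl.
Qed.

End ArrayOfFlags.

(** Lowering the j-th coordinate of x decreases the j-th rank of P1 because x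
    itself is in P1, hence also that of P2: some y in P2 below x has the same
    j-th coordinate. *)
Lemma permutation_array_share m n (P1 P2 : {set position m n}) x j :
  (forall y, rank_along j (below P1 y) = rank_along j (below P2 y)) ->
  x \in P1 -> exists y, [/\ y \in P2, pos_le y x & y j = x j].
Proof.
move=> eq_rank xP1; apply: NNPP => no_y.
have lt_j y : y \in below P2 x -> (y j < x j)%N.
  rewrite inE ltn_neqAle => /andP[yP2 le_yx]; rewrite (forallP le_yx) andbT.
  by apply/eqP => /val_inj yj; apply: no_y; exists y.
have := eq_rank x; have [xj0|xj_gt0] := posnP (x j).
  move=> /eqP; rewrite [X in _ == X](_ : _ = 0)%N; last first.
    apply: eq_card0 => k; rewrite !inE; apply/existsP => -[y /andP[/lt_j]].
    by rewrite xj0.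
  rewrite cards_eq0 => /eqP/setP/(_ (x j)); rewrite !inE => /existsP[].
  by exists x; rewrite !inE xP1 eqxx andbT; apply/forallP.
have lt_pred : ((x j).-1 < n)%N by apply: leq_ltn_trans (leq_pred _) (ltn_ord (x j)).
pose x' : position m n := [ffun i => if i == j then Ordinal lt_pred else x i].
have le_x' y : pos_le y x' = pos_le y x && (y j < x j)%N.
  apply/forallP/andP => [le|[/forallP le lt] i]; last first.
    by rewrite ffunE; case: eqP => [->|_]; rewrite ?le //= -ltnS prednK.
  have lt : (y j < x j)%N by have := le j; rewrite ffunE eqxx /= -ltnS prednK.
  split=> //; apply/forallP => i; have := le i; rewrite ffunE; case: eqP => [->|//] _.
  exact: ltnW.
have -> : below P2 x = below P2 x'.
  apply/setP => y; have := @lt_j y; rewrite !inE le_x'.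
  by case: (y \in P2) => //=; case: pos_le => //= ->.
rewrite -eq_rank => /eqP; rewrite eqn_leq => /andP[+ _]; rewrite leqNgt => /negP; apply.
apply/proper_card/properP; split.
  apply/subsetP => k; rewrite !inE => /exists_inP[y].
  rewrite !inE le_x' => /andP[yP1 /andP[le_yx _]] yk.
  by apply/exists_inP; exists y; rewrite // inE yP1.
exists (x j); rewrite !inE.
  by apply/exists_inP; exists x; rewrite // inE xP1; apply/forallP.
apply/exists_inP => -[y]; rewrite inE le_x' => /andP[_ /andP[_ lt]] /eqP e.
by rewrite e ltnn in lt.
Qed.

(** For x in P1 but not in P2, going from x to some y in P2 and back to some z
    in P1 along the same coordinate gives z strictly below x sharing this
    coordinate, and x is redundant in P1 as the join of x and z. *)
Lemma permutation_array_sub m n (P1 P2 : {set position m.+1 n}) :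
  (forall j y, rank_along j (below P1 y) = rank_along j (below P2 y)) ->
  (forall x, x \in P1 -> ~ redundant P1 x) -> P1 \subset P2.
Proof.
move=> eq_rank irr; apply/subsetP => x xP1; apply/negPn/negP => xP2.
have [y [yP2 le_yx y0]] := permutation_array_share (eq_rank ord0) xP1.
have [z [zP1 le_zy z0]] := permutation_array_share (fun y => esym (eq_rank ord0 y)) yP2.
have le_zx : pos_le z x.
  by apply/forallP => i; apply: leq_trans (forallP le_zy i) (forallP le_yx i).
have neq_zx : z != x.
  apply: contraNneq xP2 => zx; suff <- : y = x by [].
  apply/ffunP => i; apply/val_inj/eqP; rewrite eqn_leq (forallP le_yx).
  by have := forallP le_zy i; rewrite zx.
apply: (irr x xP1); exists [set x; z]; split.
- by apply/subsetP => t; rewrite !inE => /orP[]/eqP->.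
- by move=> i; rewrite big_setU1 ?big_set1 ?inE 1?eq_sym //; apply/esym/maxn_idPl/(forallP le_zx).
- by rewrite cards2 eq_sym neq_zx.
- by move=> t; rewrite !inE => /orP[]/eqP->; exists ord0; rewrite // z0 y0.
Qed.

Lemma permutation_array_unique m n (P1 P2 : {set position m.+1 n}) :
  permutation_array P1 -> permutation_array P2 ->
  (forall j y, rank_along j (below P1 y) = rank_along j (below P2 y)) -> P1 = P2.
Proof.
move=> [_ _ irr1] [_ _ irr2] eq_rank; apply/eqP; rewrite eqEsubset.
by rewrite !permutation_array_sub.
Qed.

(** * Relative position of two flags *)

Section RelativePosition.

Variables (L : fieldType) (n : nat).
Implicit Types (E F : flag L n) (g h : 'M[L]_n) (u : 'S_n).

Definition reduced_slot u (p : 'I_n * 'I_n) := (p.2 < u p.1)%N && (p.1 < u^-1%g p.2)%N.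

(** Normal form of the Bruhat cell of u modulo lower triangular matrices on the
    left: the 1 of row a is in column u a, its row vanishes to the right of it
    and its column vanishes below it.  The number of free entries is the number
    of inversions of u. *)
Definition reduced_mx u (t : 'I_n * 'I_n -> L) : 'M[L]_n :=
  \matrix_(a, c) if c == u a then 1 else if reduced_slot u (a, c) then t (a, c) else 0.

(** Row a of a matrix in normal form, p being the function that gives the
    columns of the pivots. *)
Definition reduced_row (r : 'I_n -> 'rV[L]_n) (p : 'I_n -> 'I_n) (a : 'I_n) :=
  [/\ r a 0 (p a) = 1, forall c : 'I_n, (p a < c)%N -> r a 0 c = 0 &
      forall a' : 'I_n, (a' < a)%N -> r a 0 (p a') = 0].

(** Subtracting multiples of the earlier rows clears their pivot columns one
    after the other; a column once cleared stays so, since the later rows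
    vanish there. *)
Lemma clear_pivots E h (r : 'I_n -> 'rV[L]_n) (p : 'I_n -> 'I_n) (k : 'I_n) :
  h \in unitmx ->
  (forall a : 'I_n, (a < k)%N -> reduced_row r p a /\ r a *m h \in flag_at E a) ->
  exists x : 'rV[L]_n, [/\ x *m h \in flag_at E k, x *m h \notin flag_below E k &
    forall a : 'I_n, (a < k)%N -> x 0 (p a) = 0].
Proof.
move=> h_unit rP.
suff step (i : nat) : (i <= k)%N -> exists x : 'rV[L]_n,
    [/\ x *m h \in flag_at E k, x *m h \notin flag_below E k &
    forall a : 'I_n, (a < i)%N -> x 0 (p a) = 0] by exact: (step k).
elim: i => [_|i IH lt_ik].
  have [v v_at v_below] := exists_adapted_vector E k.
  by exists (v *m invmx h); rewrite mulmxKV.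
have [x [x_at x_below x0]] := IH (ltnW lt_ik).
pose a0 := Ordinal (ltn_trans lt_ik (ltn_ord k)).
have [[r1 _ r0] r_at] := rP a0 lt_ik.
have r_below : x 0 (p a0) *: (r a0 *m h) \in flag_below E k.
  by apply/memvZ/(subvP (flag_at_below E (lt_ik : (a0 < k)%N))).
exists (x - x 0 (p a0) *: r a0); rewrite mulmxBl -scalemxAl; split.
- by rewrite memvB // (subvP (flag_below_at E k)).
- apply: contra x_below => y_below.
  by rewrite -[x *m h](subrK (x 0 (p a0) *: (r a0 *m h))) memvD.
move=> a; rewrite ltnS leq_eqVlt => /orP[/eqP ai|lt_ai].
  have -> : a = a0 by apply/val_inj.
  rewrite [LHS]mxE [X in _ + X]mxE [X in _ - X]mxE.
  by rewrite r1 mulr1 subrr.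
rewrite [LHS]mxE [X in _ + X]mxE [X in _ - X]mxE.
by rewrite (x0 a lt_ai) (r0 a lt_ai) mulr0 subr0.
Qed.

Lemma exists_reduced_rows E h (k : nat) : h \in unitmx -> (k <= n)%N ->
  exists (r : 'I_n -> 'rV[L]_n) (p : 'I_n -> 'I_n), forall a : 'I_n, (a < k)%N ->
    [/\ reduced_row r p a, r a *m h \in flag_at E a & r a *m h \notin flag_below E a].
Proof.
move=> h_unit; elim: k => [_|k IH lt_kn]; first by exists (fun=> 0), id.
have [r [p rP]] := IH (ltnW lt_kn); pose k0 := Ordinal lt_kn.
have [a|x [x_at x_below x0]] := @clear_pivots E h r p k0 h_unit.
  by move=> /rP[].
have x_neq0 : x != 0 by apply: contraNneq x_below => ->; rewrite mul0mx mem0v.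
have /rV0Pn[c0 c0P] := x_neq0.
case: (@arg_maxnP _ c0 (fun c => x 0 c != 0) val c0P) => q xq q_max.
exists (fun a => if a == k0 then (x 0 q)^-1 *: x else r a), (fun a => if a == k0 then q else p a).
move=> a; rewrite ltnS leq_eqVlt => /orP[/eqP ak|lt_ak].
  have -> : a = k0 by apply/val_inj.
  rewrite /reduced_row eqxx -scalemxAl memvZ //; split=> //; last first.
    apply: contra x_below => /(memvZ (x 0 q)).
    by rewrite scalerA divff // scale1r.
  split=> [|c lt_qc|a' lt_a']; rewrite mxE; first by rewrite mulVf.
    suff -> : x 0 c = 0 by rewrite mulr0.
    by apply/eqP; apply: contraTT lt_qc => /q_max; rewrite -leqNgt.
  by case: eqP lt_a' => [->|_] lt_a'; [rewrite ltnn in lt_a' | rewrite x0 // mulr0].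
have neq (b : 'I_n) : (b < k)%N -> (b == k0) = false.
  by move=> lt_bk; apply: contraTF lt_bk => /eqP->; rewrite ltnn.
have [[r1 r2 r3] r4 r5] := rP a lt_ak; rewrite /reduced_row (neq a lt_ak); split=> //.
split=> // a' lt_a'; rewrite (neq a') ?r3 //; exact: ltn_trans lt_a' lt_ak.
Qed.

(** Bruhat decomposition: relative to a basis adapted to one flag, any other
    flag is represented by a reduced matrix. *)
Lemma exists_reduced E h : h \in unitmx ->
  exists u t, represents (reduced_mx u t *m h) E.
Proof.
move=> h_unit; have [r [p rP]] := exists_reduced_rows E h_unit (leqnn n).
have p_inj : injective p.
  have lt_neq (a a' : 'I_n) : (a < a')%N -> p a <> p a'.
    move=> lt_aa' e; have [[r1 _ r0] _ _] := rP a' (ltn_ord a').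
    by move: r1; rewrite -e r0 // => /esym/eqP; rewrite oner_eq0.
  move=> a a' e; apply/val_inj; case: (ltngtP a a') => // lt; first by have := lt_neq _ _ lt.
  by have := lt_neq _ _ lt; rewrite e.
exists (perm p_inj), (fun ac => r ac.1 0 ac.2); apply: adapted_represents => a.
have [[r1 r2 r3] r4 r5] := rP a (ltn_ord a).
suff -> : row a (reduced_mx (perm p_inj) (fun ac => r ac.1 0 ac.2) *m h) = r a *m h by [].
rewrite row_mul; congr (_ *m h); apply/rowP => c; rewrite !mxE permE.
case: eqP => [->|neq_c]; first by rewrite r1.
rewrite /reduced_slot /= permE; case: ifP => // /negbT; rewrite negb_and -!leqNgt.
case/orP=> [le_c|le_a]; apply/esym.
  by apply: r2; rewrite ltn_neqAle le_c andbT; apply: contra_notN neq_c => /eqP/val_inj.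
have e : p ((perm p_inj)^-1 c)%g = c by rewrite -[p _](permE p_inj) permKV.
rewrite -e r3 // ltn_neqAle le_a andbT; apply: contra_notN neq_c => /eqP/val_inj <-.
by rewrite e.
Qed.

(** The pivots of a combination of rows do not cancel, so its last nonzero
    entry is the pivot of a row that occurs in the combination. *)
Lemma last_nonzero_reduced u t (y : 'rV[L]_n) k :
  (y *m reduced_mx u t) 0 k != 0 ->
  (forall c : 'I_n, (k < c)%N -> (y *m reduced_mx u t) 0 c = 0) -> y 0 (u^-1%g k) != 0.
Proof.
set z := y *m _ => zk z_gt.
have y_neq0 : y != 0 by apply: contraNneq zk => y0; rewrite /z y0 mul0mx mxE.
have /rV0Pn[a0 a0P] := y_neq0.
case: (@arg_maxnP _ a0 (fun a => y 0 a != 0) (fun a => val (u a)) a0P) => a ya.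
move=> u_max; have {u_max} a_max b : y 0 b != 0 -> (u b <= u a)%N by apply: u_max.
have z_a : z 0 (u a) = y 0 a.
  rewrite /z mxE (bigD1 a) //= mxE eqxx mulr1 big1 ?addr0 // => b neq_ba.
  have [->|yb] := eqVneq (y 0 b) 0; first by rewrite mul0r.
  rewrite mxE (inj_eq perm_inj) eq_sym (negPf neq_ba) /reduced_slot /=.
  by rewrite ltnNge a_max ?mulr0.
have z_after (c : 'I_n) : (u a < c)%N -> z 0 c = 0.
  move=> lt_ac; rewrite /z mxE big1 // => b _.
  have [->|yb] := eqVneq (y 0 b) 0; first by rewrite mul0r.
  have lt_bc := leq_ltn_trans (a_max b yb) lt_ac.
  rewrite mxE /reduced_slot /= ifN; last by apply: contraTneq lt_bc => ->; rewrite ltnn.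
  by rewrite ltnNge ltnW ?mulr0.
suff -> : k = u a by rewrite permK.
apply/val_inj; case: (ltngtP k (u a)) => // lt.
  by have := z_gt _ lt; rewrite z_a => y0; rewrite y0 eqxx in ya.
by rewrite z_after ?eqxx // in zk.
Qed.

(** Each step at which the meet acquires a vector of F is the pivot column of
    one of the first rows, by the previous lemma. *)
Lemma dim_meet_reduced E F h u t (i j : 'I_n) :
  represents h F -> represents (reduced_mx u t *m h) E ->
  (\dim (flag_at E i :&: flag_at F j) <= perm_rank u i.+1 j.+1)%N.
Proof.
move=> hF RhE; rewrite (dim_positions _ F) /perm_rank.
rewrite -[leqRHS](card_imset _ (@perm_inj _ u)); apply/subset_leq_card/subsetP => k.
rewrite inE => /positionP[v /memv_capP[vE vF] vk].
have le_kj : (k <= j)%N by rewrite -(at_pos_flag_at _ vk).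
apply/imsetP; exists (u^-1 k)%g; last by rewrite permKV.
rewrite inE permKV !ltnS le_kj andbT.
pose y := v *m invmx (reduced_mx u t *m h).
have Rh_unit := represents_unit RhE; have h_unit := represents_unit hF.
have vy : v *m invmx h = y *m reduced_mx u t.
  rewrite -[v in LHS](mulmxKV Rh_unit) -/y mulmxA mulmxK //.
have zk : (y *m reduced_mx u t) 0 k != 0.
  case/andP: vk => v_at; rewrite -vy; apply: contra => /eqP z0.
  apply/(mem_flag_belowP _ _ hF) => c; rewrite leq_eqVlt => /orP[/eqP/val_inj <- //|lt_kc].
  exact: (mem_flag_atP _ _ hF v_at).
have z_gt (c : 'I_n) : (k < c)%N -> (y *m reduced_mx u t) 0 c = 0.
  by rewrite -vy; apply: (mem_flag_atP _ _ hF); case/andP: vk.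
have := last_nonzero_reduced zk z_gt; apply: contraNT; rewrite -ltnNge => lt_i.
by apply/eqP/(mem_flag_atP _ _ RhE vE).
Qed.

Lemma schubert_perm_rank w E F h u t :
  represents h F -> represents (reduced_mx u t *m h) E -> schubert_variety w E F ->
  forall i j, (perm_rank (relative_position w) i j <= perm_rank u i j)%N.
Proof.
move=> hF RhE wEF.
have pos (i j : 'I_n) : (perm_rank (relative_position w) i.+1 j.+1 <= perm_rank u i.+1 j.+1)%N.
  apply: leq_trans (rank_upper_left L w i j) (leq_trans (wEF i j) _).
  exact: dim_meet_reduced hF RhE.
have perm_rank0 u' i j : (i == 0)%N || (j == 0)%N -> perm_rank u' i j = 0%N.
  by move=> ij; apply: eq_card0 => a; rewrite inE; case/orP: ij => /eqP->; rewrite ltn0 ?andbF.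
have clip u' i j : (0 < n)%N -> perm_rank u' i j = perm_rank u' (minn i n) (minn j n).
  by move=> _; apply: eq_card => a; rewrite !inE !leq_min !ltn_ord !andbT.
move=> i j; have [n0|n_gt0] := posnP n.
  rewrite /perm_rank [leqLHS]eq_card0 // => a.
  by have := ltn_ord a; rewrite [X in (_ < X)%N]n0.
rewrite clip // [leqRHS]clip //; case ei: (minn i n) => [|i'].
  by rewrite perm_rank0.
case ej: (minn j n) => [|j']; first by rewrite perm_rank0 ?orbT.
have lt_i' : (i' < n)%N by rewrite -ei geq_minr.
have lt_j' : (j' < n)%N by rewrite -ej geq_minr.
exact: (pos (Ordinal lt_i') (Ordinal lt_j')).
Qed.

End RelativePosition.

(** * Generic ranks *)

Section KernelDimension.

Variables (L : fieldType) (n : nat).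

Lemma free_row_free k (B : 'M[L]_(k, n)) : free [tuple row i B | i < k] -> row_free B.
Proof.
move=> /freeP B_free; rewrite -kermx_eq0; apply/eqP/matrixP => a b; rewrite [RHS]mxE.
apply: (B_free (fun b => kermx B a b)).
have : row a (kermx B) *m B = 0 by rewrite -row_mul mulmx_ker row0.
rewrite mulmx_sum_row => e; rewrite -[RHS]e; apply: eq_bigr => i _.
by rewrite -tnth_nth tnth_mktuple; congr (_ *: _); rewrite [RHS]mxE.
Qed.

Lemma row_free_free k (B : 'M[L]_(k, n)) : row_free B -> free [tuple row i B | i < k].
Proof.
move=> B_free; apply/freeP => c cB; have : (\row_i c i) *m B = 0 *m B.
  rewrite mul0mx mulmx_sum_row -[RHS]cB; apply: eq_bigr => i _.
  by rewrite -tnth_nth tnth_mktuple mxE.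
by move/(row_free_inj B_free)/rowP => c0 i; have := c0 i; rewrite !mxE.
Qed.

Lemma dim_kernel N (U : {vspace 'rV[L]_n}) (C : 'M[L]_(n, N)) :
  (forall v, v \in U <-> v *m C = 0) -> \dim U = (n - \rank C)%N.
Proof.
move=> UC; rewrite -mxrank_ker; apply/eqP; rewrite eqn_leq; apply/andP; split.
  pose B := \matrix_(i < \dim U) (vbasis U)`_i.
  have B_free : row_free B.
    apply: free_row_free; rewrite (_ : val [tuple row i B | i < \dim U] = vbasis U).
      exact: basis_free (vbasisP U).
    apply: (@eq_from_nth _ 0); first by rewrite !size_tuple.
    rewrite size_tuple => i lt_i; rewrite -[i]/(val (Ordinal lt_i)) -tnth_nth tnth_mktuple.
    by rewrite rowK.
  rewrite -(eqP B_free); apply/mxrankS/sub_kermxP/row_matrixP => i.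
  rewrite row0 row_mul rowK; apply/UC/vbasis_mem/mem_nth.
  by rewrite size_tuple.
pose B := row_base (kermx C).
have : free [tuple row i B | i < _] by apply/row_free_free/row_base_free.
move/eqP => e; rewrite -[X in (X <= _)%N](size_tuple [tuple row i B | i < _]) -e.
apply/dimvS/span_subvP => _ /mapP[i _ ->]; apply/UC/sub_kermxP.
by rewrite (submx_trans (row_sub i B)) // eq_row_base.
Qed.

Lemma rank_minor a b (A : 'M[L]_(a, b)) :
  exists f g, \det (mxsub f g A : 'M_(\rank A)) != 0.
Proof.
pose B := rowsub (maxrankfun A) A; have B_full : row_full B^T.
  by rewrite /row_full mxrank_tr; apply: maxrowsub_free.
exists (maxrankfun A), (fullrankfun B_full).
rewrite -det_tr -unitfE -[_ \in _]/(_ \in unitmx).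
have := fullrowsub_unit B_full; rewrite /B; congr (_ \in unitmx).
by apply/matrixP => i j; rewrite !mxE.
Qed.

End KernelDimension.

Lemma exists_maximum (T : Type) (f : T -> nat) B (x0 : T) :
  (forall x, (f x <= B)%N) -> exists x, forall y, (f y <= f x)%N.
Proof.
move=> fB; have [k] := ubnP (B - f x0)%N; elim: k x0 => // k IH x0; rewrite ltnS => le_k.
have [[y lt_y]|no_y] := classic (exists y, f x0 < f y)%N.
  by apply: (IH y); apply: leq_trans le_k; have := fB y; lia.
by exists x0 => y; rewrite leqNgt; apply/negP => lt; apply: no_y; exists y.
Qed.

Section GenericRank.

Variables (K : fieldType) (L : closedFieldType) (iota : {rmorphism K -> L}).

(** The rank is maximal wherever a minor of maximal size found at one point
    does not vanish. *)
Lemma generic_rank k a b (A : ('I_k -> L) -> 'M[L]_(a, b)) : polymx iota A ->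
  exists delta r, delta != 0 /\ forall t, ev iota delta t != 0 -> \rank (A t) = r.
Proof.
move=> Ap; have [t0 t0_max] :=
  exists_maximum (fun=> 0) (fun t => rank_leq_row (A t)).
have [f [g minor]] := rank_minor (A t0).
have [delta deltaE] := polyfun_det (polymx_sub f g Ap).
exists delta, (\rank (A t0)); split=> [|t].
  by apply: contraNneq minor => d0; rewrite -deltaE d0 ev0.
rewrite deltaE -unitfE -[_ \in _]/(_ \in unitmx) -row_free_unit => /eqP minor_t.
apply/eqP; rewrite eqn_leq t0_max -[X in (X <= _)%N]minor_t.
have -> : mxsub f g (A t) = rowsub f (colsub g (A t)) by rewrite -mxsub_comp.
rewrite (leq_trans (mxrankS (rowsub_sub f _))) // -mxrank_tr.
have -> : (colsub g (A t))^T = rowsub g (A t)^T by apply/matrixP => i j; rewrite !mxE.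
by rewrite (leq_trans (mxrankS (rowsub_sub g _))) // mxrank_tr.
Qed.

Lemma image_in_hypersurface k m (phi : 'I_m -> ('I_k -> L) -> L) (delta : {mpoly K[k]}) :
  (forall j, polyfun iota (phi j)) -> (k <= m)%N -> delta != 0 ->
  exists2 Q : {mpoly K[m]}, Q != 0 &
    forall t, ev iota delta t = 0 -> ev iota Q (fun j => phi j t) = 0.
Proof.
move=> phiP le_km d0; have /fin_all_exists[f fP] := phiP.
have [Q Q0 QP] := image_hypersurface iota [tuple f j | j < m] le_km d0; exists Q => // t dt.
rewrite -[RHS](QP t dt); apply: meval_eq => j; by rewrite tnth_mktuple fP.
Qed.

(** Apply the previous lemma to the hyperplane where an additional variable is
    zero. *)
Lemma small_image_in_hypersurface k m (phi : 'I_m -> ('I_k -> L) -> L) :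
  (forall j, polyfun iota (phi j)) -> (k < m)%N ->
  exists2 Q : {mpoly K[m]}, Q != 0 & forall t, ev iota Q (fun j => phi j t) = 0.
Proof.
move=> phiP lt_km; pose drop (t : 'I_k.+1 -> L) := fun i => t (lift ord_max i).
have psiP j : polyfun iota (fun t => phi j (drop t)).
  have [p pP] := phiP j; exists (p \mPo [tuple 'X_(lift ord_max i) | i < k]) => t.
  rewrite ev_comp -pP; apply: meval_eq => i; rewrite tnth_mktuple.
  by rewrite /ev map_mpolyX mevalXU.
have x_neq0 : 'X_ord_max != 0 :> {mpoly K[k.+1]}.
  by rewrite -msupp_eq0 msuppX.
have [Q Q0 QP] := image_in_hypersurface psiP lt_km x_neq0; exists Q => // t.
pose t' (j : 'I_k.+1) := if unlift ord_max j is Some i then t i else 0.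
have t'0 : ev iota 'X_ord_max t' = 0.
  by rewrite /ev map_mpolyX mevalXU /t' unlift_none.
rewrite -[RHS](QP t' t'0); apply: meval_eq => j.
have [p pP] := phiP j; rewrite -!pP; apply: meval_eq => i.
by rewrite /drop /t' liftK.
Qed.

End GenericRank.

Section MeetRank.

Variables (L : fieldType) (m n : nat).

(** Equations of a meet of flag spaces: in the basis of rows of A j, the
    coordinates after x j vanish.  The adjugate replaces the inverse to keep
    the entries polynomial. *)
Definition meet_mx (A : 'I_m -> 'M[L]_n) (x : position m n) :
    'M[L]_(n, #|{: 'I_m * 'I_n}|) :=
  \matrix_(a < n, p < #|{: 'I_m * 'I_n}|)
    if (x (enum_val p).1 < (enum_val p).2)%N
    then \adj (A (enum_val p).1) a (enum_val p).2 else 0.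

Lemma dim_flag_meet (G : 'I_m -> flag L n) (A : 'I_m -> 'M[L]_n) x :
  (forall j, represents (A j) (G j)) -> \dim (flag_meet G x) = (n - \rank (meet_mx A x))%N.
Proof.
move=> AG; apply: dim_kernel => v.
have inv j a c : invmx (A j) a c = (\det (A j))^-1 * \adj (A j) a c.
  by rewrite /invmx (represents_unit (AG j)) mxE.
have det0 j : (\det (A j))^-1 != 0.
  by rewrite invr_eq0 -unitfE; apply: represents_unit (AG j).
have coord j c : (v *m invmx (A j)) 0 c = (\det (A j))^-1 * (v *m \adj (A j)) 0 c.
  by rewrite !mxE big_distrr; apply: eq_bigr => a _ /=; rewrite inv mulrCA.
have entry p : (v *m meet_mx A x) 0 p =
    if (x (enum_val p).1 < (enum_val p).2)%N
    then (v *m \adj (A (enum_val p).1)) 0 (enum_val p).2 else 0.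
  rewrite mxE; case: ifP => lt_xc; last first.
    by rewrite big1 // => a _; rewrite mxE lt_xc mulr0.
  by rewrite mxE; apply: eq_bigr => a _; rewrite mxE lt_xc.
split=> [/mem_flag_meetP v_in|vC].
  apply/rowP => p; rewrite entry [RHS]mxE; case: (enum_val p) => j c; case: ifP => // lt_xc.
  apply/eqP; have /eqP := mem_flag_atP _ _ (AG j) (v_in j) c lt_xc.
  by rewrite coord mulf_eq0 (negPf (det0 j)).
apply/mem_flag_meetP => j; apply/(mem_flag_atP _ _ (AG j)) => c lt_xc.
have e := entry (enum_rank (j, c)); rewrite vC [LHS]mxE enum_rankK lt_xc in e.
by rewrite coord -e mulr0.
Qed.

End MeetRank.

(** * Strata of the incidence variety *)

Section Slots.

Variables (L : fieldType) (Z : finType) (slot : pred Z).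

Definition slots := {z | slot z}.

(** Points of affine space whose coordinates are indexed by the slots, as
    functions on all of Z. *)
Definition extend (s : 'I_#|{: slots}| -> L) (z : Z) : L :=
  if insub z is Some u then s (enum_rank (u : slots)) else 0.

Lemma extend_restrict (t : Z -> L) z : slot z ->
  extend (fun a => t (val (enum_val a))) z = t z.
Proof. by move=> sz; rewrite /extend insubT enum_rankK. Qed.

End Slots.

Section Strata.

Variables (K : fieldType) (L : closedFieldType) (iota : {rmorphism K -> L}).
Variables (d n : nat).

(** Coordinates of all the matrices at once: those of a reduced matrix for the
    last flag, of reduced matrices for the first d flags, and of d lower
    triangular matrices. *)
Definition param : finType := ('I_n * 'I_n + ('I_d * ('I_n * 'I_n) + 'I_d * ('I_n * 'I_n)))%type.

(** Relative positions of the last flag to the standard one, and of the other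
    flags to the last one. *)
Definition stratum : finType := ('S_n * {ffun 'I_d -> 'S_n})%type.

Implicit Types (p : stratum) (t : param -> L) (i : 'I_d).

Definition param_slot p : pred param := fun z => match z with
  | inl ac => reduced_slot p.1 ac
  | inr (inl (i, ac)) => reduced_slot (p.2 i) ac
  | inr (inr (i, ac)) => (ac.2 <= ac.1)%N
  end.

Definition param_last p t : 'M[L]_n := reduced_mx p.1 (fun ac => t (inl ac)).

Definition param_flag p t i : 'M[L]_n :=
  reduced_mx (p.2 i) (fun ac => t (inr (inl (i, ac)))) *m param_last p t.

(** The lower triangular factor makes every matrix that represents the i-th
    flag a value of the parametrization, not just one of them. *)
Definition param_rep p t i : 'M[L]_n :=
  (\matrix_(a, c) if (c <= a)%N then t (inr (inr (i, (a, c)))) else 0) *m param_flag p t i.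

Definition param_family p t (j : 'I_d.+1) : 'M[L]_n :=
  if unlift ord_max j is Some i then param_flag p t i else param_last p t.

Lemma polymx_reduced k u (f : 'I_n * 'I_n -> ('I_k -> L) -> L) :
  (forall ac, polyfun iota (f ac)) -> polymx iota (fun s => reduced_mx u (fun ac => f ac s)).
Proof.
move=> fP a c; apply: (@polyfun_ext _ _ _ _ (fun s => if c == u a then 1 else
    if reduced_slot u (a, c) then f (a, c) s else 0)); first by move=> s; rewrite [RHS]mxE.
case: (c == u a); first exact: polyfun1.
by case: (reduced_slot u (a, c)); [apply: fP | apply: polyfun0].
Qed.

Section Polynomiality.

Variable p : stratum.

Let ext (s : 'I_#|{: slots (param_slot p)}| -> L) : param -> L := extend s.

Lemma polyfun_extend z : polyfun iota (fun s => ext s z).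
Proof.
rewrite /ext /extend; case: insub => [u|]; [exact: polyfun_var | exact: polyfun0].
Qed.

Lemma polymx_param_last : polymx iota (fun s => param_last p (ext s)).
Proof. by apply: polymx_reduced => ac; apply: polyfun_extend. Qed.

Lemma polymx_param_flag i :
  polymx iota (fun s => param_flag p (ext s) i).
Proof.
apply: (polymxM (A := fun s => reduced_mx (p.2 i) (fun ac => ext s (inr (inl (i, ac)))))
  _ polymx_param_last).
by apply: polymx_reduced => ac; apply: polyfun_extend.
Qed.

Lemma polymx_param_rep i :
  polymx iota (fun s => param_rep p (ext s) i).
Proof.
apply: (polymxM (A := fun s => \matrix_(a, c) if (c <= a)%N
  then ext s (inr (inr (i, (a, c)))) else 0) _ (polymx_param_flag i)).
move=> a c; apply: (@polyfun_ext _ _ _ _ (fun s => if (c <= a)%N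
    then ext s (inr (inr (i, (a, c)))) else 0)).
  by move=> s; rewrite mxE.
by case: (c <= a)%N; [apply: polyfun_extend | apply: polyfun0].
Qed.

Lemma polyfun_entries c : polyfun iota
  (fun s => entries (param_rep p (ext s)) c).
Proof. by rewrite /entries; case: (enum_val c) => [[i a] b]; apply: polymx_param_rep. Qed.

Lemma polymx_param_family j :
  polymx iota (fun s => param_family p (ext s) j).
Proof.
rewrite /param_family; case: unlift => [i|]; [exact: polymx_param_flag | exact: polymx_param_last].
Qed.

Lemma polymx_meet x :
  polymx iota (fun s => meet_mx (param_family p (ext s)) x).
Proof.
move=> a q; apply: (@polyfun_ext _ _ _ _ (fun s => if (x (enum_val q).1 < (enum_val q).2)%N
    then \adj (param_family p (ext s) (enum_val q).1) a (enum_val q).2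
    else 0)); first by move=> s; rewrite [RHS]mxE.
case: (x _ < _)%N; last exact: polyfun0.
exact: (polymx_adj (polymx_param_family _) _ _).
Qed.

End Polynomiality.

Lemma eq_reduced_mx u (t t' : 'I_n * 'I_n -> L) :
  (forall ac, reduced_slot u ac -> t ac = t' ac) -> reduced_mx u t = reduced_mx u t'.
Proof.
by move=> eq_t; apply/matrixP => a c; rewrite !mxE; case: ifP => // _; case: ifP => // /eq_t.
Qed.

Lemma eq_param p t t' : (forall z, param_slot p z -> t z = t' z) ->
  param_last p t = param_last p t' /\
  forall i, param_flag p t i = param_flag p t' i /\ param_rep p t i = param_rep p t' i.
Proof.
move=> eq_t; have e : param_last p t = param_last p t'.
  by apply: eq_reduced_mx => ac sl; apply: eq_t.
split=> // i; have ef : param_flag p t i = param_flag p t' i.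
  by rewrite /param_flag e; congr (_ *m _); apply: eq_reduced_mx => ac sl; apply: eq_t.
split=> //; rewrite /param_rep ef; congr (_ *m _); apply/matrixP => a c; rewrite !mxE.
by case: ifP => // le_ca; apply: eq_t.
Qed.

(** The strata cover all configurations of d + 1 flags. *)
Lemma exists_param (E : 'I_d -> flag L n) (g : 'I_d -> 'M[L]_n) (F : flag L n) :
  (forall i, represents (g i) (E i)) ->
  exists p t, [/\ represents (param_last p t) F,
    forall i, represents (param_flag p t i) (E i) & forall i, param_rep p t i = g i].
Proof.
move=> gE; have [sigma [s hF]] := exists_reduced F (unitmx1 L n); rewrite mulmx1 in hF.
have h_unit := represents_unit hF; set h := reduced_mx sigma s in hF h_unit.
have /fin_all_exists[u uP] i := exists_reduced (E i) h_unit.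
have /fin_all_exists[r rP] := uP.
have /fin_all_exists[l lP] i : exists l : 'M[L]_n,
    (forall a c : 'I_n, (a < c)%N -> l a c = 0) /\ g i = l *m (reduced_mx (u i) (r i) *m h).
  by have [l l1 l2] := represents_lower (rP i) (gE i); exists l.
pose t (z : param) := match z with
  | inl ac => s ac
  | inr (inl (i, ac)) => r i ac
  | inr (inr (i, ac)) => l i ac.1 ac.2
  end.
have flagE i : param_flag (sigma, finfun u) t i = reduced_mx (u i) (r i) *m h.
  by rewrite /param_flag /= ffunE.
exists (sigma, finfun u), t; split=> // i; first by rewrite flagE.
rewrite /param_rep flagE; have [l_low ->] := lP i.
congr (_ *m _); apply/matrixP => a c; rewrite mxE; case: leqP => // lt_ac.
by rewrite l_low.
Qed.

Definition stratum_dim p := #|{: slots (param_slot p)}|.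

Lemma sum1_pairs (A B : finType) (P : A -> pred B) (Q : pred (A * B)) :
  (forall a b, Q (a, b) = P a b) -> (\sum_(z | Q z) 1 = \sum_a #|[set b | P a b]|)%N.
Proof.
move=> QP; rewrite (eq_bigr (fun a => \sum_(b | P a b) 1)%N) => [|a _]; last first.
  by rewrite sum1dep_card.
by rewrite pair_big_dep; apply: eq_bigl => -[a b] /=; rewrite QP.
Qed.

Lemma card_le_pairs : (#|[set ac : 'I_n * 'I_n | (ac.2 <= ac.1)%N]| + 'C(n, 2) = n * n)%N.
Proof.
rewrite -card_lt_pairs addnC -[X in (X * _)%N]card_ord -[X in (_ * X)%N]card_ord -card_prod.
rewrite -(cardsC [set p : 'I_n * 'I_n | (p.1 < p.2)%N]); congr addn.
by apply: eq_card => ac; rewrite !inE -leqNgt.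
Qed.

(** The number of parameters, with d * 'C(n, 2) moved to the left to avoid a
    subtraction. *)
Lemma stratum_dimE p : (stratum_dim p + d * 'C(n, 2) =
  #|inversions p.1| + \sum_i #|inversions (p.2 i)| + d * (n * n))%N.
Proof.
rewrite /stratum_dim card_sig -[#|[pred x | _]|]sum1_card /param big_sumType /= big_sumType /= -!addnA; congr addn.
  by rewrite sum1_card -card_inversions; apply: eq_card => ac; rewrite !inE.
rewrite (@sum1_pairs _ _ (fun i ac => reduced_slot (p.2 i) ac)) //; congr addn.
  by apply: eq_bigr => i _; rewrite -card_inversions.
rewrite (@sum1_pairs _ _ (fun _ (ac : 'I_n * 'I_n) => ac.2 <= ac.1)%N) //.
by rewrite sum_nat_const card_ord -mulnDr card_le_pairs.
Qed.

End Strata.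

(** * The generic table of dimensions *)

Section GenericTable.

Variables (K : fieldType) (L : closedFieldType) (iota : {rmorphism K -> L}).
Variables (d n : nat) (w : 'I_d -> 'S_n).
Hypothesis hw : (\sum_(i < d) perm_length (w i))%N = 'C(n, 2).

Implicit Types (p : stratum d n) (E : {ffun 'I_d -> flag L n}) (g : 'I_d -> 'M[L]_n).

(** The strata that meet the incidence variety of the Schubert conditions. *)
Definition admissible p :=
  forall i a b, (perm_rank (relative_position (w i)) a b <= perm_rank (p.2 i) a b)%N.

Definition top_stratum p :=
  #|inversions p.1| = 'C(n, 2) /\ forall i, p.2 i = relative_position (w i).

Lemma card_inversions_le (u : 'S_n) : (#|inversions u| <= 'C(n, 2))%N.
Proof.
by rewrite -card_lt_pairs; apply/subset_leq_card/subsetP => q; rewrite !inE => /andP[].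
Qed.

Lemma card_coord : #|Defs.coord d n| = (d * (n * n))%N.
Proof. by rewrite !card_prod !card_ord mulnA. Qed.

(** The dimension count.  By the hypothesis on the lengths, the number of
    parameters is at most d n ^ 2, the dimension of the space of d-tuples of
    matrices, with equality only for the stratum where the last flag is in
    general position and each Schubert condition holds exactly. *)
Lemma admissible_dim p : admissible p ->
  (stratum_dim p <= #|Defs.coord d n|)%N /\
  (top_stratum p \/ (stratum_dim p < #|Defs.coord d n|)%N).
Proof.
move=> adm; have le_inv i : (#|inversions (p.2 i)| <= #|inversions (relative_position (w i))|)%N.
  by case: (inversions_rank_lt (adm i)) => [->|/ltnW].
have sum_w : (\sum_i #|inversions (relative_position (w i))| + 'C(n, 2) = d * 'C(n, 2))%N.
  rewrite -[in LHS]hw -big_split /= (eq_bigr (fun=> 'C(n, 2))); last first.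
    by move=> i _; apply: inversions_relative_position.
  by rewrite sum_nat_const card_ord.
have sum_le : (\sum_i #|inversions (p.2 i)| <=
    \sum_i #|inversions (relative_position (w i))|)%N by apply: leq_sum.
have dimE := stratum_dimE p; have le_s := card_inversions_le p.1; rewrite card_coord.
split; first lia.
have [lt|ge] := ltnP (stratum_dim p) (d * (n * n)); [by right | left; split; first lia].
have eq_inv := sum_leq_eq le_inv (ltac:(lia)).
move=> i; case: (inversions_rank_lt (adm i)) => [->//|].
by rewrite eq_inv ltnn.
Qed.

(** A stratum of smaller dimension has its whole image in a hypersurface.  On
    the top stratum the table of dimensions is constant off a hypersurface
    delta = 0, whose image also is in a hypersurface. *)
Lemma stratum_generic p : admissible p ->
  exists2 Q : {mpoly K[#|Defs.coord d n|]}, Q != 0 & exists tau : position d.+1 n -> nat,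
    forall s, let t := @extend L _ (param_slot p) s in
      ev iota Q (entries (param_rep p t)) != 0 ->
      top_stratum p /\ forall x, \rank (meet_mx (param_family p t) x) = tau x.
Proof.
move=> /admissible_dim[le_dim [top|lt_dim]]; last first.
  have [Q Q0 QP] := small_image_in_hypersurface (@polyfun_entries K L iota d n p) lt_dim.
  by exists Q => //; exists (fun=> 0%N) => s /=; rewrite [ev _ _ _]QP eqxx.
have /fin_all_exists[delta /fin_all_exists[tau dP]] x :=
  generic_rank (@polymx_meet K L iota d n p x).
have delta0 : \prod_x delta x != 0.
  by apply/prodf_neq0 => x _; have [] := dP x.
have [Q Q0 QP] := image_in_hypersurface (@polyfun_entries K L iota d n p) le_dim delta0.
exists Q => //; exists tau => s /= Qs; split=> // x; have [_] := dP x; apply.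
apply: contraNneq Qs => dx; apply/eqP/QP.
by rewrite (bigD1 x) //= evM dx mul0r.
Qed.

Definition add_flag E (F : flag L n) (j : 'I_d.+1) : flag L n :=
  if unlift ord_max j is Some i then E i else F.

Lemma meet_dimE E F x : meet_dim E F x = \dim (flag_meet (add_flag E F) x).
Proof.
rewrite /meet_dim /flag_meet big_ord_recr /= /add_flag unlift_none; congr (\dim (_ :&: _)).
apply: eq_bigr => i _; have -> : widen_ord (leqnSn d) i = lift ord_max i.
  by apply/val_inj; rewrite [RHS]lift_max.
by rewrite liftK.
Qed.

Lemma generic_polynomial : exists2 Q : {mpoly K[#|Defs.coord d n|]}, Q != 0 &
  forall E g, (forall i, represents (g i) (E i)) -> ev iota Q (entries g) != 0 ->
  forall F F', schubert_intersection w E F -> schubert_intersection w E F' ->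
  forall x, meet_dim E F x = meet_dim E F' x.
Proof.
have /fin_all_exists[Q] p : exists Q : {mpoly K[#|Defs.coord d n|]}, Q != 0 /\
    exists tau : position d.+1 n -> nat, admissible p ->
    forall s, let t := @extend L _ (param_slot p) s in
      ev iota Q (entries (param_rep p t)) != 0 ->
      top_stratum p /\ forall x, \rank (meet_mx (param_family p t) x) = tau x.
  have [adm|nadm] := classic (admissible p).
    by have [Q Q0 [tau QP]] := stratum_generic adm; exists Q; split=> //; exists tau.
  by exists 1; split; [exact: oner_neq0 | exists (fun=> 0%N)].
move=> /all_and2[Q0 /fin_all_exists[tau QP]].
exists (\prod_p Q p); first by apply/prodf_neq0 => p _; apply: Q0.
move=> E g gE Qg; have table F : schubert_intersection w E F ->
    exists p, top_stratum p /\ forall x, meet_dim E F x = (n - tau p x)%N.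
  move=> wF; have [p [t [hF flagE repE]]] := exists_param F gE.
  pose s (a : 'I_#|{: slots (param_slot p)}|) := t (val (enum_val a)).
  have eq_t z : param_slot p z -> t z = @extend L _ (param_slot p) s z.
    by move=> sz; rewrite extend_restrict.
  have [eq_last eq_rest] := eq_param eq_t.
  have adm : admissible p.
    by move=> i; apply: (schubert_perm_rank (u := p.2 i) hF (flagE i) (wF i)).
  have Qp : ev iota (Q p) (entries g) != 0.
    by apply: contraNneq Qg => Qp; rewrite (bigD1 p) //= evM Qp mul0r.
  have entriesE : entries g =1 entries (param_rep p (extend s)).
    move=> c; rewrite /entries; case: (enum_val c) => -[i a] b.
    by rewrite -repE; have [_ ->] := eq_rest i.
  have [|top tauP] := QP p adm s.
    by apply: contraNneq Qp => e; rewrite -[X in _ == X]e; apply/eqP/meval_eq.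
  exists p; split=> // x; rewrite meet_dimE -(tauP x); apply: dim_flag_meet => j.
  rewrite /param_family /add_flag; case: unlift => [i|]; last by rewrite -eq_last.
  by have [<- _] := eq_rest i; apply: flagE.
move=> F F' /table[p [[inv_p pw] dimF]] /table[p' [[inv_p' p'w] dimF']] x.
rewrite dimF dimF'; suff -> : p = p' by [].
case: p p' inv_p inv_p' pw p'w {dimF dimF'} => [sigma u] [sigma' u'] /= inv inv' pw p'w.
congr pair; first exact: inversions_max_inj.
by apply/ffunP => i; rewrite pw p'w.
Qed.

End GenericTable.

(** * Open dense subsets of the product of flag varieties *)

Section OpenDense.

Variables (K : fieldType) (L : closedFieldType) (iota : {rmorphism K -> L}).
Variables (d n : nat).

Local Notation m := #|Defs.coord d n|.

Implicit Types (E : {ffun 'I_d -> flag L n}) (g : 'I_d -> 'M[L]_n) (Q : {mpoly K[m]}).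

Definition of_entries (v : 'I_m -> L) (i : 'I_d) : 'M[L]_n :=
  \matrix_(a, c) v (enum_rank (i, a, c)).

(** Lower triangular matrices encode the changes of basis adapted to a flag. *)
Definition lower (v : 'I_m -> L) (i : 'I_d) : 'M[L]_n :=
  \matrix_(a, c) if (c <= a)%N then v (enum_rank (i, a, c)) else 0.

Lemma of_entriesK v : entries (of_entries v) =1 v.
Proof.
move=> c; rewrite /entries; case e: (enum_val c) => [[i a] b].
by rewrite mxE -e enum_valK.
Qed.

Lemma evE Q v : ev iota Q v = \sum_(x <- msupp Q) iota Q@_x * \prod_i v i ^+ x i.
Proof.
rewrite [in LHS](mpolyE Q).
rewrite (big_morph (fun p => ev iota p v) (fun p q => evD iota p q v) (ev0 iota v)).
apply: eq_bigr => x _; by rewrite /ev map_mpolyZ mevalZ map_mpolyX mevalX.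
Qed.

(** Q (b g) as a polynomial in the entries of b whose coefficients are
    polynomials over K in the entries of g. *)
Lemma translate_expansion Q : exists P : {mpoly {mpoly K[m]}[m]}, forall b g,
  ev iota Q (entries (fun i => lower b i *m g i)) =
  (map_mpoly (meval (entries g) \o map_mpoly iota) P).@[b].
Proof.
pose h (c : 'I_m) : {mpoly {mpoly K[m]}[m]} := let: (i, a, c') := enum_val c in
  \sum_(l : 'I_n | (l <= a)%N) 'X_(enum_rank (i, a, l)) * ('X_(enum_rank (i, l, c')))%:MP.
exists (\sum_(x <- msupp Q) (Q@_x)%:MP%:MP * \prod_c h c ^+ x c) => b g.
pose Psi : {rmorphism {mpoly {mpoly K[m]}[m]} -> L} :=
  meval b \o map_mpoly (meval (entries g) \o map_mpoly iota).
rewrite evE -[RHS]/(Psi _) rmorph_sum; apply: eq_bigr => x _.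
rewrite rmorphM rmorph_prod; congr (_ * _).
  by rewrite /Psi /= map_mpolyC mevalC /= map_mpolyC mevalC.
apply: eq_bigr => c _; rewrite rmorphXn; congr (_ ^+ _).
rewrite /entries /h; case: (enum_val c) => -[i a] c'.
rewrite mxE rmorph_sum [RHS]big_mkcond; apply: eq_bigr => l _.
rewrite mxE; case: ifP => _; last by rewrite mul0r.
rewrite rmorphM /Psi /= map_mpolyX mevalXU map_mpolyC mevalC /= map_mpolyX mevalXU.
by rewrite /entries enum_rankK.
Qed.

(** The flags represented by some g with Q g <> 0 form an open set.  In a fixed
    representative g the condition says that Q (b g) is not identically zero on
    lower triangular b, that is, that one of its coefficients as a polynomial in
    b does not vanish at g.  Taking coefficients, not values at chosen b, is
    what keeps the equations over K, which may be finite. *)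
Lemma zariski_open_nonvanishing Q :
  zariski_open iota (fun E => exists2 g, (forall i, represents (g i) (E i)) &
    ev iota Q (entries g) != 0).
Proof.
have [P PE] := translate_expansion Q.
exists (fun q => exists x, q = P@_x) => E g gE.
have coefE x : (map_mpoly (meval (entries g) \o map_mpoly iota) P)@_x =
    ev iota P@_x (entries g) by rewrite mcoeff_map_mpoly.
split=> [[g' g'E Qg']|[_ [x ->]]].
  have /fin_all_exists[l lP] i : exists l : 'M[L]_n,
      (forall a c : 'I_n, (a < c)%N -> l a c = 0) /\ g' i = l *m g i.
    by have [l l1 l2] := represents_lower (gE i) (g'E i); exists l.
  pose b c := entries l c.
  have lowerE i : lower b i = l i.
    apply/matrixP => a c; rewrite mxE /b /entries enum_rankK.
    by case: leqP => // /(proj1 (lP i)).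
  apply: NNPP => no_q; case/negP: Qg'.
  have -> : ev iota Q (entries g') = (map_mpoly (meval (entries g) \o map_mpoly iota) P).@[b].
    rewrite -PE; apply: meval_eq => c; rewrite /entries; case: (enum_val c) => -[i a] c'.
    by rewrite lowerE; have [_ ->] := lP i.
  suff -> : map_mpoly (meval (entries g) \o map_mpoly iota) P = 0 by rewrite meval0.
  apply/mpolyP => x; rewrite coefE mcoeff0; apply/eqP/negPn/negP => Px.
  by apply: no_q; exists (P@_x) => //; exists x.
rewrite -/(ev iota _ _) -coefE => Px.
(* b has to be found invertible: its diagonal entries enter the polynomial *)
pose diag : {mpoly L[m]} := \prod_(ia : 'I_d * 'I_n) 'X_(enum_rank (ia.1, ia.2, ia.2)).
have diag0 : diag != 0 by apply/prodf_neq0 => ia _; rewrite -msupp_eq0 msuppX.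
have Pg0 : map_mpoly (meval (entries g) \o map_mpoly iota) P != 0.
  by apply: contraNneq Px => ->; rewrite mcoeff0.
have [b] := mpoly_nonvanishing (mulf_neq0 Pg0 diag0).
rewrite mevalM mulf_eq0 negb_or -PE => /andP[Qb diag_b].
exists (fun i => lower b i *m g i) => // i.
apply: represents_lower_mul (gE i) => [a c lt_ac|a].
  by rewrite mxE leqNgt lt_ac.
rewrite mxE leqnn; apply: contraNneq diag_b => b0.
by rewrite /diag rmorph_prod (bigD1 (i, a)) //= mevalXU b0 mul0r.
Qed.

Lemma is_dense_nonvanishing Q : Q != 0 ->
  is_dense (@zariski_open K L iota d n) (fun E => exists2 g,
    (forall i, represents (g i) (E i)) & ev iota Q (entries g) != 0).
Proof.
move=> Q0 V [S SP] [E1 VE1].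
have /fin_all_exists[g1 g1E] i := exists_represents (E1 i).
have [q Sq q1] := (SP E1 g1 g1E).1 VE1.
have q0 : q != 0.
  by apply: contraNneq q1 => ->; rewrite -/(ev iota _ _) ev0.
have [D DE] : polyfun iota (fun v : 'I_m -> L => \prod_i \det (of_entries v i)).
  apply: polyfun_prod => i; apply: polyfun_det => a c.
  apply: polyfun_ext (polyfun_var iota (enum_rank (i, a, c))) => v.
  by rewrite mxE.
have D0 : D != 0.
  pose v1 := entries (fun _ : 'I_d => 1%:M : 'M[L]_n).
  have : \prod_i \det (of_entries v1 i) != 0.
    apply/prodf_neq0 => i _; have -> : of_entries v1 i = 1%:M.
      by apply/matrixP => a c; rewrite mxE /v1 /entries enum_rankK.
    by rewrite det1 oner_neq0.
  by apply: contraNneq => D0; rewrite -DE D0 ev0.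
have [v] := ev_nonvanishing iota (mulf_neq0 (mulf_neq0 q0 Q0) D0).
rewrite !evM DE !mulf_eq0 !negb_or => /andP[/andP[qv Qv] /prodf_neq0 det_v].
have /fin_all_exists[F FP] i : exists F, represents (of_entries v i) F.
  by apply: exists_flag; rewrite unitmxE unitfE; apply: det_v.
have ev_entries p : ev iota p (entries (of_entries v)) = ev iota p v.
  exact/meval_eq/of_entriesK.
exists [ffun i => F i]; split.
  have rep i : represents (of_entries v i) ([ffun i => F i] i) by rewrite ffunE.
  by apply/(SP _ _ rep); exists q => //; rewrite -/(ev iota _ _) ev_entries.
by exists (of_entries v) => [i|]; rewrite ?ffunE ?ev_entries.
Qed.

End OpenDense.

Lemma has_rank_inj m n (P : {set position m.+1 n}) r r' :
  has_rank P r -> has_rank P r' -> r = r'.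
Proof. by move=> Pr Pr'; rewrite -(Pr ord0) Pr'. Qed.

(** The Schubert conditions only involve dimensions of meets of the last flag
    with one of the others: put all other coordinates of x at the maximum. *)
Lemma schubert_meet_dim (L : fieldType) d n (w : 'I_d -> 'S_n)
    (E : {ffun 'I_d -> flag L n}) (F F' : flag L n) :
  (forall x, meet_dim E F x = meet_dim E F' x) ->
  schubert_intersection w E F -> schubert_intersection w E F'.
Proof.
move=> eq_dim wF i a b; apply: leq_trans (wF i a b) _.
have lt_top : (n.-1 < n)%N by rewrite prednK // (leq_ltn_trans (leq0n a)).
pose x : position d.+1 n := [ffun j => if unlift ord_max j is Some i' then
  if i' == i then a else Ordinal lt_top else b].
have full (G : flag L n) : flag_at G (Ordinal lt_top) = fullv.
  by apply/eqP; rewrite eqEdim subvf dim_flag_at dimvf /= prednK ?(leq_ltn_trans (leq0n a)) // /dim /= mul1n.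
suff meetE G : meet_dim E G x = \dim (flag_at (E i) a :&: flag_at G b) by rewrite -!meetE eq_dim.
rewrite /meet_dim ffunE unlift_none (bigD1 i) //= big1 ?capvf => [|j neq_ji].
  suff -> : x (widen_ord (leqnSn d) i) = a by [].
  have -> : widen_ord (leqnSn d) i = lift ord_max i by apply/val_inj; rewrite [RHS]lift_max.
  by rewrite ffunE liftK eqxx.
have -> : widen_ord (leqnSn d) j = lift ord_max j by apply/val_inj; rewrite [RHS]lift_max.
by rewrite ffunE liftK (negPf neq_ji) full.
Qed.

Theorem theorem5p1 (K : fieldType) (L : closedFieldType)
    (iota : {rmorphism K -> L}) (n d : nat) (w : 'I_d -> 'S_n)
    (hw : (\sum_(i < d) perm_length (w i))%N = 'C(n, 2)) :
  exists U : {ffun 'I_d -> flag L n} -> Prop,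
    zariski_open iota U /\ is_dense (@zariski_open K L iota d n) U /\
    forall E : {ffun 'I_d -> flag L n}, U E ->
      let X := schubert_intersection w E in
      flag_variety_dim X 0 -> nonempty X ->
      exists P : {set position d.+1 n},
        unique (fun Q : {set position d.+1 n} =>
          permutation_array Q /\
          forall F : flag L n, X F ->
            forall x : position d.+1 n, has_rank (below Q x) (meet_dim E F x)) P
        /\ forall F : flag L n, X F <-> fiber_array_variety P E F.
Proof.
have [Q Q0 generic] := generic_polynomial iota hw.
exists (fun E => exists2 g, (forall i, represents (g i) (E i)) & ev iota Q (entries g) != 0).
split; first exact: zariski_open_nonvanishing.
split; first exact: is_dense_nonvanishing.
move=> E [g gE Qg] X _ [F0 XF0]; pose P := flag_array (add_flag E F0).
have P_rank F x : X F -> has_rank (below P x) (meet_dim E F x).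
  move=> XF; rewrite (generic E g gE Qg F F0) // meet_dimE.
  exact: flag_array_rank.
exists P; split.
  split=> [|P' [P'_perm P'_rank]].
    split=> [|F XF x]; [exact: flag_array_permutation | exact: P_rank].
  apply: permutation_array_unique => // [|j x]; first exact: flag_array_permutation.
  by rewrite (P_rank F0 x XF0 j) (P'_rank F0 XF0 x j).
move=> F; split=> [XF x|PF]; first exact: P_rank.
apply: (schubert_meet_dim (F := F0)) => // x.
exact: has_rank_inj (P_rank F0 x XF0) (PF x).
Qed.
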